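(* For the problem $F2\,|\,\text{exact } l_j\in\{L_1,L_2\}\,|\,C_{\max}$, Algorithm Concatenation runs in time $O(n\log n)$ and outputs a feasible schedule whose makespan is at most twice the optimal makespan.
   Context: The two-machine flow shop problem with exact delays: an instance consists of a set of jobs $J=\{1,\dots,n\}$ and, for each job $j$, a triple $(a_j,l_j,b_j)$ of nonnegative integers. Each job $j$ has an operation of length $a_j$ on machine 1 and then an operation of length $b_j$ on machine 2; the operation on machine 2 must start exactly $l_j$ time units after the operation on machine 1 is completed. Each machine processes at most one operation at a time, operations are not preempted, and start times are nonnegative. The makespan of a feasible schedule is the latest completion time of an operation, to be minimized. In $F2\,|\,\text{exact } l_j\in\{L_1,L_2\}\,|\,C_{\max}$ every $l_j$ belongs to $\{L_1,L_2\}$ for two given values $L_1,L_2$. Algorithm Concatenation: (1) set $J_k=\{j\in J: l_j=L_k\}$ for $k=1,2$, and let $\mathcal I_k$ be the instance with jobs $J_k$ and all delays equal to $L_k$; (2) compute an optimal schedule $\sigma_k$ of $\mathcal I_k$ for $k=1,2$ (an instance with a common delay $L$ is solved in $O(n\log n)$ time by shifting every second operation left by $L$, which gives the two-machine no-wait flow shop problem, solvable in $O(n\log n)$ time by the Gilmore–Gomory algorithm); (3) output the concatenation $\sigma_1\oplus\sigma_2$, which executes the jobs of $J_1$ according to $\sigma_1$ and, immediately after the completion of the last operation of $\sigma_1$, executes the jobs of $J_2$ according to $\sigma_2$ (shifted in time). *)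

(* Defs.v *)
From HB Require Import structures.
From mathcomp Require Import all_boot all_order all_algebra.

Set Implicit Arguments.
Unset Strict Implicit.
Unset Printing Implicit Defensive.

Import Order.TTheory GRing.Theory Num.Theory.

(** * The scheduling problem *)

Record job := Job { len1 : nat; delay : nat; len2 : nat }.

Section Scheduling.
Local Open Scope ring_scope.
Variables (R : archiRealFieldType) (n : nat).

(* The pair of start times (machine 1, machine 2) of every job. *)
Definition schedule := 'I_n -> R * R.

Variable I : n.-tuple job.

Definition start1 (s : schedule) (j : 'I_n) : R := (s j).1.
Definition start2 (s : schedule) (j : 'I_n) : R := (s j).2.
Definition end1 (s : schedule) (j : 'I_n) : R :=
  start1 s j + (len1 (tnth I j))%:R.
Definition end2 (s : schedule) (j : 'I_n) : R :=
  start2 s j + (len2 (tnth I j))%:R.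

(* All notions are relative to a set [J] of jobs, so that they apply to the
   whole instance ([J = setT]) and to its sub-instances.

   Two operations on the same machine are always ordered, one being completed
   before the other starts. This also applies to operations of length 0, which
   therefore cannot be placed strictly inside another operation (as in the
   no-wait flow shop problem solved by Gilmore and Gomory). *)
Definition feasible (J : {set 'I_n}) (s : schedule) : Prop :=
  [/\ forall j, j \in J -> 0 <= start1 s j /\ 0 <= start2 s j,
      forall j, j \in J -> start2 s j = end1 s j + (delay (tnth I j))%:R,
      forall i j, i \in J -> j \in J -> i != j ->
        end1 s i <= start1 s j \/ end1 s j <= start1 s i
    & forall i j, i \in J -> j \in J -> i != j ->
        end2 s i <= start2 s j \/ end2 s j <= start2 s i].

Definition makespan (J : {set 'I_n}) (s : schedule) : R :=
  \big[Num.max/0]_(j in J) Num.max (end1 s j) (end2 s j).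

Definition optimal (J : {set 'I_n}) (s : schedule) : Prop :=
  feasible J s /\ forall s', feasible J s' -> makespan J s <= makespan J s'.

Definition optimal_makespan (J : {set 'I_n}) (v : R) : Prop :=
  exists2 s, optimal J s & v = makespan J s.

Definition jobs_with_delay (L : nat) : {set 'I_n} :=
  [set j | delay (tnth I j) == L].

Definition concat_schedules (J1 : {set 'I_n}) (s1 s2 : schedule) : schedule :=
  fun j => if j \in J1 then s1 j
           else (makespan J1 s1 + start1 s2 j, makespan J1 s1 + start2 s2 j).

(* The input-output specification of Algorithm Concatenation, in which the
   optimal schedules computed in its second step are arbitrary. *)
Definition concatenation_output (L1 L2 : nat) (s : schedule) : Prop :=
  exists s1 s2 : schedule,
    [/\ optimal (jobs_with_delay L1) s1,
        optimal (jobs_with_delay L2) s2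
      & s =1 concat_schedules (jobs_with_delay L1) s1 s2].

End Scheduling.

(** * Cost model

   A computation is a pair (number of elementary steps, result). One step is
   charged for each call of a recursive function and for each array access;
   apart from such calls and accesses, the bodies below only perform a bounded
   number of arithmetic operations, comparisons, pattern matchings and
   allocations of list cells. An array is modelled by a sequence; after an
   update ([aset]) the former version of an array is never used again, so that
   updates can be done in place. *)

Definition M (A : Type) : Type := (nat * A)%type.
Definition steps A (m : M A) : nat := m.1.
Definition result A (m : M A) : A := m.2.
Definition ret A (x : A) : M A := (0, x).
Definition bind A B (m : M A) (f : A -> M B) : M B :=
  let: (c1, x) := m in let: (c2, y) := f x in (c1 + c2, y).
Definition tick : M unit := (1, tt).

Declare Scope monad_scope.
Delimit Scope monad_scope with monad.
Notation "x <- m ;; k" := (bind m (fun x => k))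
  (at level 61, m at next level, right associativity) : monad_scope.
Notation "m ;;; k" := (bind m (fun _ => k))
  (at level 61, right associativity) : monad_scope.

Local Open Scope nat_scope.
Local Open Scope monad_scope.

Definition aget A (x0 : A) (s : seq A) (i : nat) : M A :=
  tick ;;; ret (nth x0 s i).
Definition aset A (x0 : A) (s : seq A) (i : nat) (x : A) : M (seq A) :=
  tick ;;; ret (set_nth x0 s i x).
Fixpoint amake A (n : nat) (x : A) : M (seq A) :=
  tick ;;;
  if n is n'.+1 then r <- amake n' x ;; ret (x :: r) else ret [::].
Fixpoint length A (s : seq A) : M nat :=
  tick ;;; if s is _ :: s' then k <- length s' ;; ret k.+1 else ret 0.

(** * Merge sort of (key, value) pairs by increasing keys *)

Fixpoint msplit (s : seq (nat * nat)) : M (seq (nat * nat) * seq (nat * nat)) :=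
  tick ;;;
  if s is x :: s' then p <- msplit s' ;; ret (x :: p.2, p.1)
  else ret ([::], [::]).

Fixpoint mmerge (s1 : seq (nat * nat)) : seq (nat * nat) -> M (seq (nat * nat)) :=
  if s1 is x1 :: s1' then
    fix mmerge_s1 (s2 : seq (nat * nat)) : M (seq (nat * nat)) :=
      tick ;;;
      if s2 is x2 :: s2' then
        if x1.1 <= x2.1 then r <- mmerge s1' s2 ;; ret (x1 :: r)
        else r <- mmerge_s1 s2' ;; ret (x2 :: r)
      else ret s1
  else fun s2 => tick ;;; ret s2.

(* [fuel] only ensures structural termination. *)
Fixpoint msort_rec (fuel : nat) (s : seq (nat * nat)) : M (seq (nat * nat)) :=
  tick ;;;
  if fuel is fuel'.+1 then
    if s is [:: _, _ & _] then
      p <- msplit s ;;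
      l <- msort_rec fuel' p.1 ;;
      r <- msort_rec fuel' p.2 ;;
      mmerge l r
    else ret s
  else ret s.

Definition msort (s : seq (nat * nat)) : M (seq (nat * nat)) :=
  msort_rec (size s) s.

(** * Disjoint sets

   [labels] maps each element to the label of its class and [classes] maps each
   label to the size and the list of the elements of its class; the smaller
   class is absorbed by the larger one. *)

Record partition_state := PartitionState {
  labels : seq nat;
  classes : seq (nat * seq nat)
}.

Fixpoint singletons (k v : nat) : M partition_state :=
  tick ;;;
  if k is k'.+1 then
    p <- singletons k' v.+1 ;;
    ret (PartitionState (v :: labels p) ((1, [:: v]) :: classes p))
  else ret (PartitionState [::] [::]).

Fixpoint absorb (l : nat) (xs : seq nat) (lab ys : seq nat) :
    M (seq nat * seq nat) :=
  tick ;;;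
  if xs is x :: xs' then
    lab' <- aset 0 lab x l ;; absorb l xs' lab' (x :: ys)
  else ret (lab, ys).

(* Also returns whether [u] and [v] were in different classes. *)
Definition union (p : partition_state) (u v : nat) : M (partition_state * bool) :=
  lu <- aget 0 (labels p) u ;;
  lv <- aget 0 (labels p) v ;;
  if lu == lv then ret (p, false) else
  cu <- aget (0, [::]) (classes p) lu ;;
  cv <- aget (0, [::]) (classes p) lv ;;
  let: (small, l, large) := if cu.1 <= cv.1 then (cu, lv, cv) else (cv, lu, cu) in
  q <- absorb l small.2 (labels p) large.2 ;;
  cl <- aset (0, [::]) (classes p) l (small.1 + large.1, q.2) ;;
  ret (PartitionState q.1 cl, true).

(** * The Gilmore-Gomory algorithm for a common delay

   After all second operations are shifted left by the common delay, the job
   [j] can start no earlier than [len1 i + (len2 i - len1 j)] (with truncated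
   subtraction) after the start of its predecessor [i]. Minimizing the makespan
   is thus the travelling salesman problem with distance [len2 i - len1 j] from
   [i] to [j], whose nodes are a dummy job 0 with two operations of length 0 and
   the jobs of the list [js], numbered from 1. The list [js] consists of pairs
   (index in the whole instance, job). *)

Fixpoint keys (f : job -> nat) (v : nat) (js : seq (nat * job)) :
    M (seq (nat * nat)) :=
  tick ;;;
  if js is x :: js' then r <- keys f v.+1 js' ;; ret ((f x.2, v) :: r)
  else ret [::].

(* Below, [sa] and [sb] are the nodes sorted by first, resp. second, operation
   length, as (length, node) pairs. In the optimal assignment the successor of
   the k-th node of [sb] is the k-th node of [sa]. *)

Fixpoint assignment_cycles (sa sb : seq (nat * nat)) (p : partition_state) :
    M partition_state :=
  tick ;;;
  match sa, sb with
  | x :: sa', y :: sb' =>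
      q <- union p y.2 x.2 ;; assignment_cycles sa' sb' q.1
  | _, _ => ret p
  end.

(* The cost of exchanging the successors of the nodes of ranks [k] and [k.+1]
   in [sb], paired with [k]. *)
Fixpoint exchange_costs (k : nat) (sa sb : seq (nat * nat)) :
    M (seq (nat * nat)) :=
  tick ;;;
  match sa, sb with
  | x :: ((x' :: _) as sa'), y :: ((y' :: _) as sb') =>
      r <- exchange_costs k.+1 sa' sb' ;;
      ret ((minn x'.1 y'.1 - maxn x.1 y.1, k) :: r)
  | _, _ => ret [::]
  end.

(* Kruskal's algorithm on the cycles of the assignment; [sel] is the array of
   the selected exchanges. *)
Fixpoint kruskal (sb : seq (nat * nat)) (es : seq (nat * nat))
    (p : partition_state) (sel : seq bool) : M (seq bool) :=
  tick ;;;
  if es is e :: es' then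
    y <- aget (0, 0) sb e.2 ;;
    y' <- aget (0, 0) sb e.2.+1 ;;
    q <- union p y.2 y'.2 ;;
    sel' <- (if q.2 then aset false sel e.2 true else ret sel) ;;
    kruskal sb es' q.1 sel'
  else ret sel.

(* Performs the selected exchanges on the ranks >= k, where [v] is the current
   successor of the node of rank [k], and [sel], [sa], [sb] start at the ranks
   [k], [k.+1] and [k.+1], respectively. The exchange at [k] precedes the one at
   [k.+1] if and only if the (k.+1)-st smallest first operation is not longer
   than the (k.+1)-st smallest second operation. Returns the new successor of
   the node of rank [k] and those of the nodes of higher ranks. *)
Fixpoint exchange (v : nat) (sel : seq bool) (sa sb : seq (nat * nat)) :
    M (nat * seq nat) :=
  tick ;;;
  match sel, sa, sb with
  | e :: sel', x :: sa', y :: sb' =>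
      if ~~ e then
        r <- exchange x.2 sel' sa' sb' ;; ret (v, r.1 :: r.2)
      else if x.1 <= y.1 then
        r <- exchange v sel' sa' sb' ;; ret (x.2, r.1 :: r.2)
      else
        r <- exchange x.2 sel' sa' sb' ;; ret (r.1, v :: r.2)
  | _, _, _ => ret (v, [::])
  end.

Fixpoint set_successors (sb : seq (nat * nat)) (vs : seq nat) (succ : seq nat) :
    M (seq nat) :=
  tick ;;;
  match sb, vs with
  | y :: sb', v :: vs' =>
      succ' <- aset 0 succ y.2 v ;; set_successors sb' vs' succ'
  | _, _ => ret succ
  end.

(* The [m] nodes that follow [v]. *)
Fixpoint follow (m : nat) (succ : seq nat) (v : nat) : M (seq nat) :=
  tick ;;;
  if m is m'.+1 then
    w <- aget 0 succ v ;; r <- follow m' succ w ;; ret (w :: r)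
  else ret [::].

(* Start times of the jobs of the sequence [vs], given the start time [t] of
   the preceding job [x], together with the makespan. *)
Fixpoint timetable (L : nat) (js : seq (nat * job)) (t : nat) (x : job)
    (vs : seq nat) : M (seq (nat * (nat * nat)) * nat) :=
  tick ;;;
  if vs is v :: vs' then
    y <- aget (0, Job 0 0 0) js v.-1 ;;
    let t1 := t + len1 x + (len2 x - len1 y.2) in
    let t2 := t1 + len1 y.2 + L in
    r <- timetable L js t1 y.2 vs' ;;
    ret ((y.1, (t1, t2)) :: r.1, maxn (t2 + len2 y.2) r.2)
  else ret ([::], 0).

Definition gilmore_gomory (L : nat) (js : seq (nat * job)) :
    M (seq (nat * (nat * nat)) * nat) :=
  m <- length js ;;
  ka <- keys len1 1 js ;;
  kb <- keys len2 1 js ;;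
  sa <- msort ((0, 0) :: ka) ;;
  sb <- msort ((0, 0) :: kb) ;;
  p0 <- singletons m.+1 0 ;;
  p <- assignment_cycles sa sb p0 ;;
  es0 <- exchange_costs 0 sa sb ;;
  es <- msort es0 ;;
  sel0 <- amake m false ;;
  sel <- kruskal sb es p sel0 ;;
  r <- exchange (head (0, 0) sa).2 sel (behead sa) (behead sb) ;;
  succ0 <- amake m.+1 0 ;;
  succ <- set_successors sb (r.1 :: r.2) succ0 ;;
  vs <- follow m succ 0 ;;
  timetable L js 0 (Job 0 0 0) vs.

(** * Algorithm Concatenation *)

Fixpoint select_delay (L i : nat) (s : seq job) : M (seq (nat * job)) :=
  tick ;;;
  if s is x :: s' then
    r <- select_delay L i.+1 s' ;;
    ret (if delay x == L then (i, x) :: r else r)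
  else ret [::].

Fixpoint write_schedule (shift : nat) (es : seq (nat * (nat * nat)))
    (out : seq (nat * nat)) : M (seq (nat * nat)) :=
  tick ;;;
  if es is e :: es' then
    out' <- aset (0, 0) out e.1 (shift + e.2.1, shift + e.2.2) ;;
    write_schedule shift es' out'
  else ret out.

(* Returns the array of the pairs of start times of the jobs. The jobs with
   delay [L1] are written last, so that the case [L1 = L2] is harmless. *)
Definition concatenation (L1 L2 : nat) (I : seq job) : M (seq (nat * nat)) :=
  js1 <- select_delay L1 0 I ;;
  js2 <- select_delay L2 0 I ;;
  s1 <- gilmore_gomory L1 js1 ;;
  s2 <- gilmore_gomory L2 js2 ;;
  n <- length I ;;
  out0 <- amake n (0, 0) ;;
  out <- write_schedule s1.2 s2.1 out0 ;;
  write_schedule 0 s1.1 out.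

Definition schedule_of (R : archiRealFieldType) (n : nat)
    (out : seq (nat * nat)) : schedule R n :=
  fun j => let e := nth (0, 0) out j in (e.1%:R%R, e.2%:R%R).
Arguments schedule_of R n out : clear implicits.

(* Main.v *)
Require Import Defs.
From mathcomp Require Import all_boot all_order all_algebra zify.

Set Implicit Arguments.
Unset Strict Implicit.
Unset Printing Implicit Defensive.

Import Order.TTheory GRing.Theory Num.Theory.

(** Restricting a schedule of all jobs to the jobs of one delay does not increase
    its makespan, so each of the two optimal makespans added up by the
    concatenation is at most the optimum. Rounding start times down preserves
    feasibility, so optima exist and are attained by integral schedules.

    For a common delay, a schedule amounts to a tour of the jobs and a dummy job,
    of cost [sum_v (b v - a (succ v))]. Rank the nodes by [a] and by [b]; the
    assignment of the k-th [a] to the k-th [b] is cheapest. Counting, for every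
    level [t], the nodes with [a (succ v) <= t < b v] shows that any tour costs
    at least this assignment plus the exchange costs of the pairs of ranks
    [k, k+1] that it crosses, i.e. such that some node of rank [> k] has a
    successor of rank [<= k]. The crossed pairs connect the cycles of the
    assignment, so they cost at least a minimum spanning tree. Conversely, the
    exchanges of a spanning tree merge the cycles into a single one in any order,
    and in the order of the algorithm their costs add up exactly.

    The cost of the disjoint sets is amortized by the potential
    [sum_v log (size of the class of v)]. *)

(** * Merging of equivalence classes *)

(** Cycles of an assignment, disjoint sets and spanning trees meet in one notion: boolean
    equivalence relations on node numbers, merged along edges. A merge is the least equivalence
    above the old one and the new edge, so inclusions follow from minimality instead of from
    manipulations of paths. Two orders compete in the algorithm. Exchanges are selected by
    increasing cost but performed in an order dictated by comparisons of lengths, so acyclicity of a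
    set of edges has to be invariant under permutation. For connectivity the order is then
    immaterial. For the cost it is not: exchanges at adjacent ranks share a node, and the later one
    acts on a successor that the earlier one has already changed. The comparison at the shared rank
    selects the order for which this change leaves the cost of the later exchange unaltered.
    Connectedness of a tour is likewise expressed by equivalences: every equivalence containing its
    arcs relates all nodes. Applied to the relation generated by the assignment and the crossed
    ranks, this says that the crossed ranks span. *)

Section Merging.
Variable T : eqType.
Implicit Types (E F : rel T) (x y u v : T).

Definition is_equiv E := [/\ reflexive E, symmetric E & transitive E].

Definition merge_at E x y : rel T :=
  fun u v => [|| E u v, E u x && E y v | E u y && E x v].

Lemma merge_equiv E x y : is_equiv E -> is_equiv (merge_at E x y).
Proof.
move=> [rE sE tE]; rewrite /merge_at; split.
- by move=> u; rewrite rE.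
- move=> u v; rewrite (sE u v) (sE u x) (sE u y) (sE y v) (sE x v).
  by case: (E v u); case: (E x u); case: (E v y); case: (E y u); case: (E v x).
- move=> v u w.
  have tr := fun a b c (p : E a b) (q : E b c) => tE b a c p q.
  case/or3P => [h1|/andP[h1 h1']|/andP[h1 h1']];
  case/or3P => [h2|/andP[h2 h2']|/andP[h2 h2']]; apply/or3P.
  + by apply: Or31; apply: tr h1 h2.
  + by apply: Or32; rewrite (tr _ _ _ h1 h2).
  + by apply: Or33; rewrite (tr _ _ _ h1 h2).
  + by apply: Or32; rewrite h1 (tr _ _ _ h1' h2).
  + by apply: Or32; rewrite h1 h2'.
  + by apply: Or31; apply: tr h1 h2'.
  + by apply: Or33; rewrite h1 (tr _ _ _ h1' h2).
  + by apply: Or31; apply: tr h1 h2'.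
  + by apply: Or33; rewrite h1 h2'.
Qed.

Lemma merge_sub E x y u v : E u v -> merge_at E x y u v.
Proof. by rewrite /merge_at => ->. Qed.

Lemma merge_edge E x y : is_equiv E -> merge_at E x y x y.
Proof. by case=> rE _ _; rewrite /merge_at !rE orbT. Qed.

(** With [merge_sub] and [merge_edge], this makes [merge_at] the least equivalence above [E]
    relating [x] and [y]; later inclusions use only this property. *)
Lemma merge_min E F x y : is_equiv F -> subrel E F -> F x y ->
  subrel (merge_at E x y) F.
Proof.
move=> [rF sF tF] EF Fxy u v /or3P[/EF//|/andP[/EF h /EF h']|/andP[/EF h /EF h']].
  exact: tF h (tF _ _ _ Fxy h').
by apply: tF h (tF _ _ _ _ h'); rewrite sF.
Qed.

Variable y : nat -> T.

(* The edge [k] joins [y k] and [y k.+1]. *)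
Definition merges E (ks : seq nat) : rel T :=
  foldl (fun E k => merge_at E (y k) (y k.+1)) E ks.

Lemma merges_equiv E ks : is_equiv E -> is_equiv (merges E ks).
Proof. by elim: ks E => //= k ks IH E eE; apply/IH/merge_equiv. Qed.

Lemma merges_sub E ks : subrel E (merges E ks).
Proof.
elim: ks E => [|k ks IH] E u v Euv //=.
by apply: IH; apply: merge_sub.
Qed.

Lemma merges_edge E ks k : is_equiv E -> k \in ks -> merges E ks (y k) (y k.+1).
Proof.
elim: ks E => //= j ks IH E eE; rewrite inE => /orP[/eqP ->|kks].
  by apply/merges_sub/merge_edge.
by apply: IH => //; apply: merge_equiv.
Qed.

Lemma merges_min E F ks : is_equiv F -> subrel E F ->
  (forall k, k \in ks -> F (y k) (y k.+1)) -> subrel (merges E ks) F.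
Proof.
move=> eF; elim: ks E => [|k ks IH] E EF ksF //=.
apply: IH => [|j jks]; last by apply: ksF; rewrite inE jks orbT.
by apply: merge_min => //; apply: ksF; rewrite inE eqxx.
Qed.

Lemma merges_mono E F ks js : is_equiv E -> is_equiv F -> subrel E F ->
  {subset ks <= js} -> subrel (merges E ks) (merges F js).
Proof.
move=> eE eF EF kj; apply: merges_min; first exact: merges_equiv.
  by move=> u v /EF; apply: merges_sub.
by move=> k /kj kjs; apply: merges_edge.
Qed.

Lemma mergesC E j k : is_equiv E -> merges E [:: j; k] =2 merges E [:: k; j].
Proof.
move=> eE u v; apply/idP/idP; apply: merges_mono => // i;
by rewrite !inE orbC.
Qed.

Lemma eq_merge E F a b : E =2 F -> merge_at E a b =2 merge_at F a b.
Proof. by move=> EF u v; rewrite /merge_at !EF. Qed.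

Lemma eq_merges E F ks : E =2 F -> merges E ks =2 merges F ks.
Proof. by elim: ks E F => //= k ks IH E F EF; apply: IH; apply: eq_merge. Qed.

Fixpoint acyclic E ks :=
  if ks is k :: ks' then
    ~~ E (y k) (y k.+1) && acyclic (merge_at E (y k) (y k.+1)) ks'
  else true.

Lemma eq_acyclic E F ks : E =2 F -> acyclic E ks = acyclic F ks.
Proof.
by elim: ks E F => //= k ks IH E F EF; rewrite EF (IH _ _ (eq_merge _ _ EF)).
Qed.

Lemma acyclic_swap E j k ks : is_equiv E ->
  acyclic E [:: j, k & ks] = acyclic E [:: k, j & ks].
Proof.
move=> eE /=; rewrite !andbA; congr andb; last first.
  by apply: eq_acyclic; apply: (mergesC j k eE).
case: eE => rE sE tE; rewrite /merge_at.
rewrite (sE (y k) (y j)) (sE (y j.+1) (y k.+1)).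
rewrite (andbC (E (y k) (y j.+1))).
by case: (E (y j) (y j.+1)); case: (E (y k) (y k.+1)); rewrite //= ?andbF ?andbT.
Qed.

Lemma acyclic_front E ks k js : is_equiv E ->
  acyclic E (ks ++ k :: js) = acyclic E (k :: ks ++ js).
Proof.
elim: ks E => //= j ks IH E eE.
rewrite (IH _ (merge_equiv _ _ eE)).
exact: (acyclic_swap j k (ks ++ js) eE).
Qed.

(** Bridges the order of selection, by cost, and the order in which the exchanges are performed.
    Adjacent transpositions suffice, by [acyclic_swap]. *)
Lemma acyclic_perm E ks js : is_equiv E -> perm_eq ks js ->
  acyclic E ks = acyclic E js.
Proof.
elim: ks E js => [|k ks IH] E js eE; first by rewrite perm_sym => /perm_nilP ->.
move=> pkj; have kjs : k \in js by rewrite -(perm_mem pkj) mem_head.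
case/splitPr: kjs pkj => js1 js2 pkj.
rewrite acyclic_front //=; congr andb; apply: IH; first exact: merge_equiv.
by rewrite -(perm_cons k) (perm_trans pkj) // -cat1s perm_catCA.
Qed.

Fixpoint greedy E ks :=
  if ks is k :: ks' then
    if E (y k) (y k.+1) then greedy E ks'
    else k :: greedy (merge_at E (y k) (y k.+1)) ks'
  else [::].

Lemma greedy_acyclic E ks : acyclic E (greedy E ks).
Proof.
elim: ks E => //= k ks IH E; case: ifPn => [_|nE]; first exact: IH.
by rewrite /= nE IH.
Qed.

Lemma greedy_subseq E ks : subseq (greedy E ks) ks.
Proof.
elim: ks E => //= k ks IH E; case: ifP => _; last by rewrite eqxx.
exact: subseq_trans (IH E) (subseq_cons _ _).
Qed.

(** A skipped edge has equivalent endpoints, so merging along it would change nothing: the greedy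
    choice spans as much as all the edges. *)
Lemma greedy_merges E ks : is_equiv E ->
  subrel (merges E ks) (merges E (greedy E ks)).
Proof.
elim: ks E => [|k ks IH] E eE //=; case: ifP => [Ek|_]; last first.
  by apply: IH; apply: merge_equiv.
move=> u v Muv; apply: (IH E eE) => //.
have eM := merge_equiv (y k) (y k.+1) eE.
move: u v Muv; apply: merges_mono => //.
by apply: merge_min.
Qed.

(** [D] will be the set of node numbers: the relations stored by the disjoint sets and those given
    by orbits are compared only there. *)
Lemma eq_in_greedy (D : pred T) E F ks : {in D &, E =2 F} ->
  (forall k, k \in ks -> D (y k) /\ D (y k.+1)) -> greedy E ks = greedy F ks.
Proof.
elim: ks E F => //= k ks IH E F EF Dk.
have [|D1 D2] := Dk k; first by rewrite inE eqxx.
have Dk' j : j \in ks -> D (y j) /\ D (y j.+1).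
  by move=> jks; apply: Dk; rewrite inE jks orbT.
rewrite (EF _ _ D1 D2) (IH E F) // (IH (merge_at E _ _) (merge_at F (y k) (y k.+1))) //.
by move=> u v Du Dv; rewrite /merge_at !EF.
Qed.

(* The edge [f] is the first one of [ks] whose addition joins [a] and [b]. *)
Lemma merges_exchange E a b ks : is_equiv E -> uniq ks ->
  ~~ E a b -> merges E ks a b ->
  exists2 f, f \in ks & merges (merge_at E a b) (rem f ks) (y f) (y f.+1).
Proof.
elim: ks E => [|f ks IH] E eE /=; first by move=> _ /negP.
move=> /andP[fks uks] nEab Mab.
case: (boolP (merge_at E (y f) (y f.+1) a b)) => [h|nh].
  exists f; rewrite ?mem_head // eqxx; apply: merges_sub.
  case: eE => _ sE _; case/or3P: h => [h|/andP[h1 h2]|/andP[h1 h2]].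
  - by rewrite h in nEab.
  - by apply/or3P/Or32; rewrite sE h1 sE h2.
  - by apply/or3P/Or33; rewrite h1 h2.
have eF := merge_equiv (y f) (y f.+1) eE.
have [g gks Mg] := IH _ eF uks nh Mab.
exists g; first by rewrite inE gks orbT.
case: eqP => [fg|_]; first by rewrite fg gks in fks.
have eab := merge_equiv a b eE.
move: (y g) (y g.+1) Mg; apply: merges_min => /=.
- exact: merges_equiv (merge_equiv _ _ eab).
- apply: merge_min.
  + exact: merges_equiv (merge_equiv _ _ eab).
  + apply: merge_min.
    * exact: merges_equiv (merge_equiv _ _ eab).
    * by move=> u v Euv; apply/merges_sub/merge_sub/merge_sub.
    * exact/merges_sub/merge_edge.
  + by apply/merges_sub/merge_sub/merge_edge.
- by move=> k kg; apply: merges_edge => //; apply: merge_equiv.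
Qed.

(* Kruskal's algorithm: [greedy] processes the edges by increasing weight. *)
Lemma greedy_min (D : pred T) (w : nat -> nat) E ks js :
  is_equiv E -> (forall k, k \in ks -> D (y k) /\ D (y k.+1)) ->
  sorted leq (map w ks) -> uniq ks -> uniq js -> {subset js <= ks} ->
  (forall u v, D u -> D v -> merges E js u v) ->
  \sum_(k <- greedy E ks) w k <= \sum_(k <- js) w k.
Proof.
elim: ks E js => [|k ks IH] E js eE Dk.
  by move=> _ _ _ _ _; rewrite /= big_nil.
have [|D1 D2] := Dk k; first by rewrite inE eqxx.
have Dk' j : j \in ks -> D (y j) /\ D (y j.+1).
  by move=> jks; apply: Dk; rewrite inE jks orbT.
rewrite [map _ _]/= => srt /andP[kks uks] ujs jk tot.
have srt' : sorted leq (map w ks) by apply: path_sorted srt.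
have remks f : f \in js -> f = k \/ k \notin js -> {subset rem f js <= ks}.
  move=> fjs H g; rewrite mem_rem_uniq // inE => /andP[gf gjs].
  have := jk _ gjs; rewrite inE => /orP[/eqP gk|//].
  by case: H gf gjs => [->|kn]; rewrite gk ?eqxx // (negPf kn).
have eM := merge_equiv (y k) (y k.+1) eE.
(* An edge whose endpoints are joined without it can be removed from a spanning set. *)
have cont f F : is_equiv F -> subrel E F -> merges F (rem f js) (y f) (y f.+1) ->
    forall u v, D u -> D v -> merges F (rem f js) u v.
  move=> eF EF Ff u v Du Dv; have := tot u v Du Dv.
  move: u v {Du Dv}; apply: merges_min; first exact: merges_equiv.
    by move=> u v /EF; apply: merges_sub.
  move=> j jjs; have [->//|jf] := eqVneq j f.
  by apply: merges_edge => //; rewrite mem_rem_uniq // inE jf.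
have sumrem f : f \in js -> \sum_(j <- js) w j = w f + \sum_(j <- rem f js) w j.
  by move=> fjs; rewrite (perm_big _ (perm_to_rem fjs)) big_cons.
(* If the greedy choice skips [k], then [k] is redundant in [js] as well and can only increase its
   weight. *)
rewrite /=; case: ifPn => [Ek|nEk].
  case: (boolP (k \in js)) => [kjs|kjs].
    rewrite (sumrem _ kjs); apply: leq_trans (leq_addl _ _).
    apply: IH => //; first exact: rem_uniq.
      by apply: remks => //; left.
    by apply: cont => //; apply: merges_sub.
  apply: IH => // g gjs; have := jk _ gjs; rewrite inE => /orP[/eqP gk|//].
  by rewrite -gk gjs in kjs.
rewrite big_cons.
case: (boolP (k \in js)) => [kjs|kjs].
  rewrite (sumrem _ kjs) leq_add2l; apply: IH => //; first exact: rem_uniq.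
    by apply: remks => //; left.
  apply: cont => //; first by move=> u v; apply: merge_sub.
  exact/merges_sub/merge_edge.
(* [k] is chosen but absent from [js]: it replaces an edge [f] of the cycle that it closes, and
   [w k <= w f] because [f] comes after [k] in the sorted list. *)
have [f fjs Mf] := merges_exchange eE ujs nEk (tot _ _ D1 D2).
rewrite (sumrem _ fjs); apply: leq_add.
  have fks : f \in ks.
    have := jk _ fjs; rewrite inE => /orP[/eqP fk|//].
    by rewrite -fk fjs in kjs.
  have := order_path_min leq_trans srt => /allP; apply.
  exact: map_f.
apply: IH => //; first exact: rem_uniq.
  by apply: remks => //; right.
by apply: cont => // u v; apply: merge_sub.
Qed.

End Merging.

(** * Orbits of a permutation when two successors are exchanged *)

Section OrbitMerging.
Variable T : finType.

Lemma fconnect_equiv (f : T -> T) : injective f -> is_equiv (fconnect f).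
Proof.
move=> injf; split; first exact: connect0; last exact: connect_trans.
exact: fconnect_sym.
Qed.

Definition swapped (f : T -> T) x y u :=
  f (if u == x then y else if u == y then x else u).

Lemma swapped_inj f x y : injective f -> injective (swapped f x y).
Proof.
move=> injf u v /injf.
by case: (u =P x) => [->|]; case: (v =P x) => [->|]; do ?case: (_ =P y) => [->|] //;
   congruence.
Qed.

(** The new map sends [y] to [f x] and then agrees with [f] until the orbit closes at [x], since
    this orbit does not meet [y]. *)
Lemma swapped_orbit f x y : injective f -> ~~ fconnect f x y ->
  forall w, fconnect f x w -> fconnect (swapped f x y) y w.
Proof.
move=> injf nxy; set g := swapped f x y.
have reach n : n < order f x -> fconnect g y (iter n.+1 f x).
  elim: n => [|n IH] ltn.
    have -> : iter 1 f x = g y by rewrite /g /swapped eqxx; case: eqP => [->|].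
    exact: fconnect1.
  apply: connect_trans (IH (ltnW ltn)) _.
  have -> : iter n.+2 f x = g (iter n.+1 f x); last exact: fconnect1.
  rewrite /g /swapped; case: eqP => [e|_].
    have := findex_iter ltn; rewrite e.
    by have := findex_iter (order_gt0 f x) => /= ->.
  case: eqP => [e|//]; move: nxy; rewrite -e.
  by rewrite fconnect_iter.
move=> w xw; rewrite -(iter_findex xw); case E: (findex f x w) => [|n] /=.
  (* [x] itself is reached last, after a full turn. *)
  have := reach (order f x).-1; rewrite prednK ?order_gt0 // iter_order //.
  exact.
by apply: reach; rewrite -ltnS -E ltnW // ltnS findex_max.
Qed.

(** Exchanging successors across two cycles joins them into one; within a single cycle it would
    split it, whence the hypothesis. *)
Lemma fconnect_swapped f x y : injective f -> ~~ fconnect f x y ->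
  fconnect (swapped f x y) =2 merge_at (fconnect f) x y.
Proof.
move=> injf nxy; have eF := fconnect_equiv injf; case: (eF) => rF sF tF.
have injg := @swapped_inj f x y injf.
have [rG sG tG] := fconnect_equiv injg.
have eM := merge_equiv x y eF; case: (eM) => rM sM tM.
have toy := swapped_orbit injf nxy.
have nyx : ~~ fconnect f y x by rewrite sF.
have tox w : fconnect f y w -> fconnect (swapped f x y) x w.
  move=> yw; have e : swapped f x y =1 swapped f y x.
    by move=> u; rewrite /swapped; do 2!case: eqP => // ->.
  by rewrite (eq_fconnect e); apply: swapped_orbit.
have gxy : fconnect (swapped f x y) x y by apply: tox.
move=> u v; apply/idP/idP.
  move=> /iter_findex <-; elim: (findex _ u v) => [|k IH]; first exact: rM.
  rewrite iterS; apply: tM IH _; move: (iter k _ u) => {k v}u; rewrite /swapped.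
  have s1 w : fconnect f w (f w) by apply: fconnect1.
  case: eqP => [->|_]; first by rewrite /merge_at rF s1 orbT.
  by case: eqP => [->|_]; rewrite /merge_at ?rF ?s1 ?orbT.
have sub : subrel (fconnect f) (fconnect (swapped f x y)).
  apply: connect_sub => {}u {}v /eqP <-.
  have s1 w : fconnect f w (f w) by apply: fconnect1.
  case: (u =P x) => [->|nx].
    by apply: tG (gxy) _; apply: toy.
  case: (u =P y) => [->|ny].
    by apply: tG (tox _ (s1 y)); rewrite sG.
  have -> : f u = swapped f x y u; last exact: fconnect1.
  by rewrite /swapped; case: eqP => //; case: eqP.
by move: u v; apply: merge_min.
Qed.

End OrbitMerging.

(** * Steps and results *)

Arguments bind : simpl never.
Arguments tick : simpl never.
Arguments ret : simpl never.
Arguments steps : simpl never.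
Arguments result : simpl never.

Lemma steps_bind A B (m : M A) (f : A -> M B) :
  steps (bind m f) = steps m + steps (f (result m)).
Proof. by case: m => c x; rewrite /bind /=; case: (f x). Qed.

(** Used with [eapply] to bound a program one instruction at a time, the total being collected in an
    existential variable. *)
Lemma steps_bind_le A B (k : M A) (f : A -> M B) c1 c2 :
  steps k <= c1 -> steps (f (result k)) <= c2 -> steps (bind k f) <= c1 + c2.
Proof. by move=> h1 h2; rewrite steps_bind leq_add. Qed.

Lemma result_bind A B (m : M A) (f : A -> M B) :
  result (bind m f) = result (f (result m)).
Proof. by case: m => c x; rewrite /bind /=; case: (f x). Qed.

Lemma steps_ret A (x : A) : steps (ret x) = 0. Proof. by []. Qed.
Lemma result_ret A (x : A) : result (ret x) = x. Proof. by []. Qed.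
Lemma steps_tick : steps tick = 1. Proof. by []. Qed.
Lemma steps_aget A (x0 : A) s i : steps (aget x0 s i) = 1. Proof. by []. Qed.
Lemma result_aget A (x0 : A) s i : result (aget x0 s i) = nth x0 s i.
Proof. by []. Qed.
Lemma steps_aset A (x0 : A) s i x : steps (aset x0 s i x) = 1.
Proof. by []. Qed.
Lemma result_aset A (x0 : A) s i x : result (aset x0 s i x) = set_nth x0 s i x.
Proof. by []. Qed.

Definition stepsE := (steps_bind, steps_ret, steps_tick, steps_aget, steps_aset).
Definition resultE := (result_bind, result_ret, result_aget, result_aset).

Lemma steps_length A (s : seq A) : steps (length s) = (size s).+1.
Proof. by elim: s => //= x s IH; rewrite !stepsE IH; lia. Qed.

Lemma result_length A (s : seq A) : result (length s) = size s.
Proof. by elim: s => //= x s IH; rewrite !resultE IH. Qed.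

Lemma steps_amake A n (x : A) : steps (amake n x) = n.+1.
Proof. by elim: n => //= n IH; rewrite !stepsE IH; lia. Qed.

Lemma result_amake A n (x : A) : result (amake n x) = nseq n x.
Proof. by elim: n => //= n IH; rewrite !resultE IH. Qed.

(** * Merge sort *)

Definition le_key : rel (nat * nat) := fun x y => x.1 <= y.1.

Lemma msplit_spec s : let p := result (msplit s) in
  [/\ steps (msplit s) = (size s).+1, perm_eq (p.1 ++ p.2) s,
      size p.1 = uphalf (size s) & size p.2 = (size s)./2].
Proof.
elim: s => //= x s [IH1 IH2 IH3 IH4]; rewrite !stepsE !resultE /= IH1.
split; [lia| |by rewrite IH4|by rewrite IH3].
by rewrite perm_cons perm_catC.
Qed.

Lemma mmerge_cons x1 s1 x2 s2 : mmerge (x1 :: s1) (x2 :: s2) =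
  bind tick (fun _ => if x1.1 <= x2.1
    then bind (mmerge s1 (x2 :: s2)) (fun r => ret (x1 :: r))
    else bind (mmerge (x1 :: s1) s2) (fun r => ret (x2 :: r))).
Proof. by []. Qed.

Lemma steps_mmerge s1 s2 : steps (mmerge s1 s2) <= (size s1 + size s2).+1.
Proof.
have sz (x : nat * nat) s : size (x :: s) = (size s).+1 by [].
elim: s1 s2 => [|x1 s1 IH1] s2; first by rewrite /= !stepsE; lia.
elim: s2 => [|x2 s2 IH2]; first by rewrite /= !stepsE; lia.
rewrite mmerge_cons !stepsE; case: ifP => _; rewrite !stepsE.
  by have := IH1 (x2 :: s2); rewrite !sz; lia.
by move: IH2; rewrite !sz; lia.
Qed.

Lemma perm_mmerge s1 s2 : perm_eq (result (mmerge s1 s2)) (s1 ++ s2).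
Proof.
elim: s1 s2 => [|x1 s1 IH1] s2 //.
elim: s2 => [|x2 s2 IH2]; first by rewrite cats0.
rewrite mmerge_cons !resultE; case: ifP => _; rewrite !resultE.
  by rewrite perm_cons.
rewrite -(cat1s x2 s2) perm_sym perm_catCA perm_sym.
by rewrite cat1s perm_cons.
Qed.

Lemma sorted_mmerge s1 s2 : sorted le_key s1 -> sorted le_key s2 ->
  sorted le_key (result (mmerge s1 s2)).
Proof.
have tr : transitive le_key by move=> y x z; apply: leq_trans.
elim: s1 s2 => [|x1 s1 IH1] s2 //.
elim: s2 => [|x2 s2 IH2] // srt1 srt2.
rewrite mmerge_cons !resultE; case: ifP => c; rewrite !resultE.
  rewrite /= path_sortedE // IH1 // ?(path_sorted srt1) // andbT.
  rewrite (perm_all _ (perm_mmerge _ _)) all_cat.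
  rewrite (order_path_min tr srt1) /=.
  apply/andP; split; first exact: c.
  apply: sub_all (order_path_min tr srt2) => z; exact: leq_trans.
rewrite -[sorted _ (_ :: _)]/(path le_key x2 _).
rewrite path_sortedE // IH2 // ?(path_sorted srt2) // andbT.
rewrite (perm_all _ (perm_mmerge _ _)) all_cat.
rewrite (order_path_min tr srt2) andbT [all _ _]/=.
have c' : le_key x2 x1 by rewrite /le_key; lia.
rewrite c'; apply: sub_all (order_path_min tr srt1) => z; exact: leq_trans.
Qed.

Lemma msort_rec_cons fuel x x' s (s' := [:: x, x' & s]) :
  msort_rec fuel.+1 s' = bind tick (fun _ => bind (msplit s') (fun p =>
    bind (msort_rec fuel p.1) (fun l =>
    bind (msort_rec fuel p.2) (fun r => mmerge l r)))).
Proof. by []. Qed.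

Lemma perm_msort_rec fuel s : perm_eq (result (msort_rec fuel s)) s.
Proof.
elim: fuel s => [|fuel IH] // [|x [|x' s]] //.
rewrite msort_rec_cons; case: (msplit_spec [:: x, x' & s]).
move: (msplit _) => q _ pp _ _; rewrite !resultE.
apply: perm_trans (perm_mmerge _ _) _.
by apply: perm_trans pp; apply: perm_cat.
Qed.

Lemma sorted_msort_rec fuel s : size s <= fuel ->
  sorted le_key (result (msort_rec fuel s)).
Proof.
elim: fuel s => [|fuel IH]; first by case.
move=> [|x [|x' s]] // sz.
rewrite msort_rec_cons; case: (msplit_spec [:: x, x' & s]).
move: (msplit _) => q _ _ s1 s2; rewrite !resultE.
apply: sorted_mmerge; apply: IH; rewrite ?s1 ?s2; move: sz => /=; lia.
Qed.

(* The constants absorb the linear terms of the recursion: with [n] split into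
   [n1 + n2], [2n + 3 + (4 n1 - 3) + (4 n2 - 3) <= 2n + (4n - 3)]. *)
Lemma steps_msort_rec fuel s k : 0 < size s -> size s <= 2 ^ k ->
  steps (msort_rec fuel s) + 3 <= 2 * size s * k + 4 * size s.
Proof.
elim: fuel s k => [|fuel IH] s k.
  by move=> h _; rewrite [msort_rec _ _]/= !stepsE; nia.
case: s => [|x [|x' s]] // _; first by rewrite [msort_rec _ _]/= !stepsE /=; nia.
set s' := [:: x, x' & s]; move=> sz.
rewrite msort_rec_cons; case: (msplit_spec s').
have sz2 : 2 <= size s' by [].
move: (msplit _) => q st _ s1 s2; rewrite !stepsE st.
set p := result q in s1 s2 *.
have := steps_mmerge (result (msort_rec fuel p.1)) (result (msort_rec fuel p.2)).
rewrite !(perm_size (perm_msort_rec _ _)) => hm.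
case: k sz => [|k] sz; first by move: sz sz2; rewrite expn0; lia.
have e2 : 2 ^ k.+1 = 2 * 2 ^ k by rewrite expnS.
have h1 := IH p.1 k; have h2 := IH p.2 k.
have := h1 _ _; have := h2 _ _; rewrite s1 s2 in hm *.
have sumh : uphalf (size s') + (size s')./2 = size s' by lia.
move=> /(_ ltac:(lia) ltac:(lia)) H2 /(_ ltac:(lia) ltac:(lia)) H1.
nia.
Qed.

Lemma perm_msort s : perm_eq (result (msort s)) s.
Proof. exact: perm_msort_rec. Qed.

Lemma sorted_msort s : sorted le_key (result (msort s)).
Proof. exact: sorted_msort_rec. Qed.

Lemma steps_msort s k : size s <= 2 ^ k ->
  steps (msort s) <= 2 * size s * k + 4 * size s + 1.
Proof.
case: (posnP (size s)) => [/size0nil ->|h /(steps_msort_rec (size s) h)] //.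
by rewrite -/(msort s); lia.
Qed.

(** * Disjoint sets *)

Section Partition.
Variable N : nat.
Implicit Types (p : partition_state) (u v : nat).

Definition label p v := nth 0 (labels p) v.
Definition same p : rel nat := fun u v => label p u == label p v.

(** Only labels carried by some element are constrained, because the entry of an absorbed label is
    never erased. *)
Definition partition_wf p :=
  size (labels p) = N /\
  forall v, v < N -> let c := nth (0, [::]) (classes p) (label p v) in
    c.1 = size c.2 /\ perm_eq c.2 (filter (fun w => label p w == label p v) (iota 0 N)).

(* An element is moved to a class of at least twice the size each time that it
   is relabelled, so the relabellings are paid by the increase of [potential]. *)
Definition potential p :=
  \sum_(v <- iota 0 N)
    trunc_log 2 (count (fun w => label p w == label p v) (iota 0 N)).

Lemma potential_ub p k : N <= 2 ^ k -> potential p <= N * k.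
Proof.
move=> Nk; rewrite /potential -[X in _ <= X * k](size_iota 0) -sum1_size big_distrl /=.
apply: leq_sum => v _; rewrite mul1n.
set c := count _ _.
have cN : c <= 2 ^ k by apply: leq_trans Nk; rewrite -[N](size_iota 0); apply: count_size.
have [c0|c0] := posnP c; first by rewrite c0 trunc_log0.
by rewrite -(leq_exp2l (m := 2)) //; apply: leq_trans cN; apply: trunc_logP.
Qed.

Lemma steps_absorb l xs lab ys : steps (absorb l xs lab ys) = (size xs).*2.+1.
Proof. by elim: xs lab ys => //= x xs IH lab ys; rewrite !stepsE IH; lia. Qed.

Lemma size_absorb l xs lab ys : all (fun x => x < size lab) xs ->
  size (result (absorb l xs lab ys)).1 = size lab.
Proof.
elim: xs lab ys => //= x xs IH lab ys /andP[h1 h2].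
have e : size (set_nth 0 lab x l) = size lab by rewrite size_set_nth; lia.
by rewrite !resultE IH ?e.
Qed.

Lemma nth_absorb l xs lab ys v :
  nth 0 (result (absorb l xs lab ys)).1 v = if v \in xs then l else nth 0 lab v.
Proof.
elim: xs lab ys => //= x xs IH lab ys; rewrite !resultE IH nth_set_nth /= inE.
by case: (v \in xs); rewrite ?orbT // orbF.
Qed.

Lemma result_absorb2 l xs lab ys : (result (absorb l xs lab ys)).2 = catrev xs ys.
Proof. by elim: xs lab ys => //= x xs IH lab ys; rewrite !resultE IH. Qed.

(** The class [ls] of [vs] is absorbed by the class [l] of [vl]. Each moved element gains at least 1
    in [trunc_log], and no other class shrinks. [catrev] reflects that [absorb] pushes the moved
    elements one by one. *)
Lemma relabel_spec p q ls l vs vl cs cl :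
  partition_wf p -> vs < N -> vl < N -> label p vs = ls -> label p vl = l ->
  ls != l -> size (labels q) = N ->
  cs = nth (0, [::]) (classes p) ls -> cl = nth (0, [::]) (classes p) l ->
  cs.1 <= cl.1 ->
  (forall v, v < N -> label q v = if label p v == ls then l else label p v) ->
  classes q = set_nth (0, [::]) (classes p) l (cs.1 + cl.1, catrev cs.2 cl.2) ->
  partition_wf q /\ potential p + size cs.2 <= potential q.
Proof.
move=> [szp wfp] vsN vlN els el nls szq ecs ecl csl lq cq.
have [cs1 cs2] := wfp vs vsN; have [cl1 cl2] := wfp vl vlN.
rewrite els -ecs in cs1 cs2; rewrite el -ecl in cl1 cl2.
(* The predicate [a] is arbitrary in order to serve twice: for the lists of members, compared
   through [permP], and with [a] constantly true for the sizes in the potential. *)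
have cnt a x : count (fun w => a w && (label q w == x)) (iota 0 N) =
    if x == l then count (fun w => a w && (label p w == ls)) (iota 0 N)
                 + count (fun w => a w && (label p w == l)) (iota 0 N)
    else if x == ls then 0 else count (fun w => a w && (label p w == x)) (iota 0 N).
  rewrite (@eq_in_count _ _
    (fun w => a w && ((if label p w == ls then l else label p w) == x))); last first.
    by move=> w; rewrite mem_iota => wN; rewrite lq.
  elim: (iota 0 N) => [|w s IH] /=; first by case: (x == l); case: (x == ls).
  rewrite {}IH; case: (a w) => //=; rewrite ?add0n //.
  have [->|xl] := eqVneq x l.
    by case: (eqVneq (label p w) ls) => [->|_]; rewrite ?eqxx ?(negPf nls) /=; lia.
  have [->|xls] := eqVneq x ls.
    by case: (eqVneq (label p w) ls) => [_|/negPf ->] //; rewrite eq_sym (negPf nls).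
  case: (eqVneq (label p w) ls) => [->|_] //.
  by rewrite eq_sym (negPf xl) eq_sym (negPf xls).
have qv v : v < N -> (label q v == ls) = false /\
    (label q v == l) = (label p v == ls) || (label p v == l).
  move=> vN; rewrite lq //; case: (eqVneq (label p v) ls) => [_|nv].
    by rewrite eq_sym (negPf nls) eqxx.
  by rewrite (negPf nv).
split.
  split=> // v vN; rewrite /= cq nth_set_nth /=.
  case: (eqVneq (label q v) l) => [ev|nv].
    rewrite /= catrevE size_cat size_rev cs1 cl1; split=> //.
    apply/permP => a; rewrite count_cat count_rev (permP cs2) (permP cl2).
    by rewrite !count_filter (cnt a) ev eqxx.
  have qp : label q v = label p v.
    by move: nv; rewrite lq //; case: (label p v == ls) => //; rewrite eqxx.
  have [h1 h2] := wfp v vN; rewrite qp; split=> //.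
  apply: perm_trans h2 _; apply/permP => a.
  by rewrite !count_filter (cnt a) -qp (negPf nv); have [->] := qv v vN.
have cntT x := cnt xpredT x; rewrite /= in cntT.
rewrite (perm_size cs2) size_filter /potential.
rewrite -sum1_count [X in _ + X]big_mkcond -big_split /= big_seq [X in _ <= X]big_seq.
apply: leq_sum => v; rewrite mem_iota => vN.
have c0 : 0 < count (fun w => label p w == label p v) (iota 0 N).
  by rewrite -has_count; apply/hasP; exists v; rewrite ?mem_iota.
rewrite cntT; have [-> ->] := qv v vN.
case: (eqVneq (label p v) ls) => [ev|nv] /=.
  rewrite addn1 -trunc_log2_double //; apply: leq_trunc_log.
  rewrite ev -addnn leq_add2l.
  by move: csl; rewrite cs1 cl1 (perm_size cs2) (perm_size cl2) !size_filter.
rewrite addn0; case: (eqVneq (label p v) l) => [->|nl].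
  by apply: leq_trunc_log; apply: leq_addl.
by rewrite lq // (negPf nv).
Qed.

(** The 6 steps are four reads, the last call of [absorb] and one write. Every relabelling costs a
    call and a write, whence the factor 2 in front of the potential. *)
Lemma union_spec p u v : partition_wf p -> u < N -> v < N ->
  let r := result (union p u v) in
  [/\ partition_wf r.1, r.2 = ~~ same p u v,
      {in gtn N &, same r.1 =2 merge_at (same p) u v}
    & steps (union p u v) + 2 * potential p <= 6 + 2 * potential r.1].
Proof.
move=> wfp uN vN; rewrite /union !stepsE !resultE /= -/(label p u) -/(label p v).
have -> : same p u v = (label p u == label p v) by [].
case: (eqVneq (label p u) (label p v)) => [e|ne].
  rewrite !stepsE !resultE /=; split=> //; last by lia.
  move=> x y _ _; rewrite /merge_at /same e.
  case: (eqVneq (label p x) (label p y)) => //= nxy.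
  rewrite (eq_sym (label p v)).
  case: (eqVneq (label p y) (label p v)); rewrite ?andbF // => <-.
  by rewrite (negPf nxy).
rewrite !stepsE !resultE /=.
set cu := nth _ _ (label p u); set cv := nth _ _ (label p v).
(* The part of [union] that follows the choice of the smaller class, in a form that covers both
   outcomes of the comparison. *)
pose S vs vl := 
  let cs := nth (0, [::]) (classes p) (label p vs) in
  let cl := nth (0, [::]) (classes p) (label p vl) in
  bind (absorb (label p vl) cs.2 (labels p) cl.2) (fun q =>
  bind (aset (0, [::]) (classes p) (label p vl) (cs.1 + cl.1, q.2)) (fun c =>
  ret (PartitionState q.1 c, true))).
have SP vs vl : vs < N -> vl < N -> label p vs != label p vl ->
    (nth (0, [::]) (classes p) (label p vs)).1 <=
    (nth (0, [::]) (classes p) (label p vl)).1 ->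
  [/\ partition_wf (result (S vs vl)).1, (result (S vs vl)).2 = true,
      {in gtn N &, same (result (S vs vl)).1 =2 merge_at (same p) vs vl} &
      steps (S vs vl) + 2 * potential p <= 2 + 2 * potential (result (S vs vl)).1].
  move=> vsN vlN nsl le.
  rewrite /S !stepsE !resultE /= steps_absorb result_absorb2.
  set cs := nth _ _ _ in le *; set cl := nth _ _ (label p vl) in le *.
  set q := PartitionState _ _.
  have [wf1 wf2] := wfp; have [_ cs2] := wf2 vs vsN.
  have mcs w : w < N -> (w \in cs.2) = (label p w == label p vs).
    by move=> wN; rewrite (perm_mem cs2) mem_filter mem_iota /= wN andbT.
  have lq w : w < N ->
      label q w = if label p w == label p vs then label p vl else label p w.
    by move=> wN; rewrite /label /= nth_absorb mcs.
  have szq : size (labels q) = N.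
    rewrite /= size_absorb // wf1; apply/allP => w.
    by rewrite (perm_mem cs2) mem_filter mem_iota => /andP[_].
  have [] := @relabel_spec p q _ _ vs vl cs cl wfp vsN vlN erefl erefl nsl szq.
  - by [].
  - by [].
  - by [].
  - by [].
  - by [].
  move=> wfq pot; split=> //; last by lia.
  move=> x y xN yN; rewrite /same /merge_at !lq //.
  rewrite (eq_sym (label p vl) (label p y)) (eq_sym (label p vs) (label p y)).
  have [exs|nxs] := eqVneq (label p x) (label p vs);
  have [eys|nys] := eqVneq (label p y) (label p vs); rewrite ?exs ?eys ?eqxx //=;
    rewrite ?(negPf nsl) /= ?orbF //.
  + by rewrite eq_sym; case: eqP; rewrite ?orbT // eq_sym (negPf nys).
  + by rewrite (negPf nxs) andbT.
  + by rewrite andbF orbF.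
case: ifP => le.
  have [] := SP u v uN vN ne le; rewrite /S !stepsE !resultE /= => h1 h2 h3 h4.
  by split=> //; lia.
have le' : cv.1 <= cu.1 by lia.
have ne' : label p v != label p u by rewrite eq_sym.
have [] := SP v u vN uN ne' le'; rewrite /S !stepsE !resultE /= => h1 h2 h3 h4.
split=> //.
by move=> x y xN yN; rewrite h3 // /merge_at; congr orb; apply: orbC.
Qed.

Lemma label_singletons k v : (forall w, w < k ->
  nth 0 (labels (result (singletons k v))) w = v + w /\
  nth (0, [::]) (classes (result (singletons k v))) w = (1, [:: v + w])) /\
  size (labels (result (singletons k v))) = k.
Proof.
elim: k v => [|k IH] v; first by split.
rewrite /= !resultE /=; have [IH1 IH2] := IH v.+1; split; last by rewrite IH2.
by case=> [|w] wk /=; rewrite ?addn0 // -addSnnS; apply: IH1.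
Qed.

Lemma steps_singletons k v : steps (singletons k v) = k.+1.
Proof. by elim: k v => //= k IH v; rewrite !stepsE IH; lia. Qed.

Lemma singletons_spec (p := result (singletons N 0)) :
  partition_wf p /\ {in gtn N &, same p =2 eq_op}.
Proof.
have [h sz] := label_singletons N 0; rewrite -/p in h sz.
have lp w : w < N -> label p w = w by move=> /h[].
split; last by move=> x y xN yN; rewrite /same !lp.
split=> // v vN; have [_] := h v vN; rewrite /= lp // => -> /=; split=> //.
rewrite (@eq_in_filter _ _ (pred1 v)); last first.
  by move=> w; rewrite mem_iota => wN; rewrite lp.
by rewrite filter_pred1_uniq ?iota_uniq // mem_iota.
Qed.

End Partition.

(** * Loops of the Gilmore-Gomory algorithm *)

Lemma same_equiv p : is_equiv (same p).
Proof.
split=> [u|u v|v u w]; rewrite /same ?eqxx //; last by move=> /eqP -> /eqP ->.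
Qed.

Section PartitionLoops.
Variable N : nat.

(** The final partition is described as the least equivalence above the initial one and the arcs, a
    form that induction on the arcs preserves; orbits enter only afterwards. Each arc costs one call
    and one [union], hence 7. *)
Lemma assignment_cycles_spec sa sb p : partition_wf N p ->
  all (gtn N) (map snd sa) -> all (gtn N) (map snd sb) ->
  let q := result (assignment_cycles sa sb p) in
  [/\ partition_wf N q,
      {in gtn N &, subrel (same p) (same q)},
      forall e, e \in zip (map snd sb) (map snd sa) -> same q e.1 e.2,
      forall F : rel nat, is_equiv F -> {in gtn N &, subrel (same p) F} ->
        (forall e, e \in zip (map snd sb) (map snd sa) -> F e.1 e.2) ->
        {in gtn N &, subrel (same q) F}
    & steps (assignment_cycles sa sb p) + 2 * potential N p <=
      (7 * size sa).+1 + 2 * potential N q].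
Proof.
elim: sa sb p => [|x sa IH] [|y sb] p wfp /=.
1-3: by rewrite !stepsE !resultE => _ _; split=> //; lia.
move=> /andP[xN saN] /andP[yN sbN].
case: (union_spec wfp yN xN); move: (union p y.2 x.2) => r wfr _ sr st.
rewrite !stepsE !resultE.
have [wfq h1 h2 h3 h4] := IH sb _ wfr saN sbN.
have pr : {in gtn N &, subrel (same p) (same (result r).1)}.
  by move=> u v uN vN uv; rewrite sr //; apply: merge_sub.
split=> //.
- by move=> u v uN vN uv; apply: h1 => //; apply: pr.
- move=> e; rewrite inE => /orP[/eqP -> /=|]; last exact: h2.
  by apply: h1 => //; rewrite sr //; apply: merge_edge; apply: same_equiv.
- move=> F eF pF eqF; apply: h3 => //; last first.
    by move=> e ez; apply: eqF; rewrite inE ez orbT.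
  have Fyx : F y.2 x.2 by apply: (eqF (y.2, x.2)); rewrite inE eqxx.
  case: eF => rF sF tF u v uN vN; rewrite sr // => /or3P[|/andP[]|/andP[]].
  + exact: pF.
  + move=> /(pF _ _ uN yN) h /(pF _ _ xN vN) h'; exact: tF h (tF _ _ _ Fyx h').
  + move=> /(pF _ _ uN xN) h /(pF _ _ yN vN) h'.
    by apply: tF h (tF _ _ _ _ h'); rewrite sF.
- by move: st h4; lia.
Qed.

Variables (sb : seq (nat * nat)).
Let y k := (nth (0, 0) sb k).2.

Lemma kruskal_cons e es p sel (r := union p (y e.2) (y e.2.+1))
    (sel' := if (result r).2 then set_nth false sel e.2 true else sel) :
  result (kruskal sb (e :: es) p sel) =
    result (kruskal sb es (result r).1 sel') /\
  steps (kruskal sb (e :: es) p sel) <=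
    4 + steps r + steps (kruskal sb es (result r).1 sel').
Proof.
have -> : kruskal sb (e :: es) p sel = bind tick (fun _ =>
  bind (aget (0, 0) sb e.2) (fun z => bind (aget (0, 0) sb e.2.+1) (fun z' =>
  bind (union p z.2 z'.2) (fun q =>
  bind (if q.2 then aset false sel e.2 true else ret sel) (fun sel' =>
  kruskal sb es q.1 sel'))))) by [].
rewrite 4!result_bind 4!steps_bind !steps_tick !result_aget !steps_aget.
rewrite -/(y e.2) -/(y e.2.+1) -/r {}/sel'.
move: r => r; rewrite result_bind steps_bind.
case: ((result r).2); rewrite ?steps_aset ?result_aset; split=> //;
by rewrite ?steps_ret ?result_ret; lia.
Qed.

Lemma kruskal_spec (es : seq (nat * nat)) p sel : partition_wf N p ->
  (forall k, k \in map snd es -> y k < N /\ y k.+1 < N) ->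
  forall k, nth false (result (kruskal sb es p sel)) k =
    nth false sel k || (k \in greedy y (same p) (map snd es)).
Proof.
elim: es p sel => [|e es IH] p sel wfp yN k; first by rewrite /= orbF.
have [|y1 y2] := yN e.2; first by rewrite inE eqxx.
have yN' j : j \in map snd es -> y j < N /\ y j.+1 < N.
  by move=> h; apply: yN; rewrite inE h orbT.
rewrite (kruskal_cons e es p sel).1 /=; case: (union_spec wfp y1 y2).
move: (union p _ _) => r wfr er sr _; rewrite IH // er.
case: (boolP (same p _ _)) => [h|h] /=; rewrite ?nth_set_nth /=.
  congr (_ || (_ \in _)); apply: (@eq_in_greedy _ y (gtn N)) => // u v uN vN.
  rewrite sr //; apply/idP/idP; last exact: merge_sub.
  by apply: (@merge_min _ (same p) (same p)) => //; apply: same_equiv.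
rewrite inE (@eq_in_greedy _ y (gtn N) _ (merge_at (same p) (y e.2) (y e.2.+1))) //.
by case: eqP => //=; rewrite orbT.
Qed.

(** Per edge, 4 steps of the loop and 6 of [union]; the relabellings are paid by the potential,
    which never exceeds [N * K]. *)
Lemma steps_kruskal (es : seq (nat * nat)) p sel K : partition_wf N p -> N <= 2 ^ K ->
  (forall k, k \in map snd es -> y k < N /\ y k.+1 < N) ->
  steps (kruskal sb es p sel) + 2 * potential N p <=
  (10 * size es).+1 + 2 * (N * K).
Proof.
move=> + NK; elim: es p sel => [|e es IH] p sel wfp yN.
  by rewrite /= !stepsE; have := potential_ub p NK; lia.
have [|y1 y2] := yN e.2; first by rewrite inE eqxx.
have yN' j : j \in map snd es -> y j < N /\ y j.+1 < N.
  by move=> h; apply: yN; rewrite inE h orbT.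
have := (kruskal_cons e es p sel).2; case: (union_spec wfp y1 y2).
move: (union p _ _) => r wfr er sr st; set sel' := if _ then _ else _.
rewrite -[size (e :: es)]/((size es).+1).
by have := IH _ sel' wfr yN'; lia.
Qed.

Lemma size_kruskal (es : seq (nat * nat)) p sel : all (gtn (size sel)) (map snd es) ->
  size (result (kruskal sb es p sel)) = size sel.
Proof.
elim: es p sel => // e es IH p sel /andP[h1 h2].
rewrite (kruskal_cons e es p sel).1; set sel' := if _ then _ else _.
have e' : size sel' = size sel.
  by rewrite /sel'; case: ifP => _ //; rewrite size_set_nth //; move: h1 => /=; lia.
by rewrite IH e'.
Qed.

End PartitionLoops.

Lemma steps_keys f v js : steps (keys f v js) = (size js).+1.
Proof. by elim: js v => //= x js IH v; rewrite !stepsE IH; lia. Qed.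

Lemma result_keys f v js : result (keys f v js) =
  [seq (f (nth (0, Job 0 0 0) js i).2, v + i) | i <- iota 0 (size js)].
Proof.
elim: js v => //= x js IH v; rewrite !resultE IH addn0; congr cons.
rewrite (iotaDl 1 0) -map_comp; apply: eq_map => i /=.
by rewrite add1n addnS addSn.
Qed.

Lemma exchange_costs_cons k x x' sa y y' sb :
  exchange_costs k [:: x, x' & sa] [:: y, y' & sb] =
  bind tick (fun _ => bind (exchange_costs k.+1 (x' :: sa) (y' :: sb)) (fun r =>
    ret ((minn x'.1 y'.1 - maxn x.1 y.1, k) :: r))).
Proof. by []. Qed.

Lemma steps_exchange_costs k sa sb : steps (exchange_costs k sa sb) <= (size sa).+1.
Proof.
elim: sa sb k => [|x sa IH] sb k; first by rewrite /= stepsE.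
case: sb => [|y sb]; first by case: sa IH => [|x' sa] IH; rewrite /= stepsE.
case: sa IH => [|x' sa] IH; case: sb => [|y' sb].
1-3: by rewrite /= !stepsE.
rewrite exchange_costs_cons; have := IH (y' :: sb) k.+1.
by move: (exchange_costs _ _ _) => r; rewrite !stepsE /=; lia.
Qed.

(** The length of the overlap of two gaps, between ranks [i] and [i.+1] of [sa] and of [sb]: the
    number of levels that separate the lower from the higher ranks in both lists. *)
Definition swap_cost (sa sb : seq (nat * nat)) i :=
  minn (nth (0, 0) sa i.+1).1 (nth (0, 0) sb i.+1).1
  - maxn (nth (0, 0) sa i).1 (nth (0, 0) sb i).1.

Lemma result_exchange_costs k sa sb : size sa = size sb ->
  result (exchange_costs k sa sb) =
  [seq (swap_cost sa sb i, k + i) | i <- iota 0 (size sa).-1].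
Proof.
elim: sa sb k => [|x sa IH] [|y sb] k //.
case: sa IH => [|x' sa] IH; case: sb => [|y' sb] // sz.
rewrite exchange_costs_cons; have := IH (y' :: sb) k.+1.
move: (exchange_costs _ _ _) => r; rewrite !resultE.
move=> -> /=; last by case: sz => ->.
rewrite /swap_cost /= addn0; congr cons.
rewrite [in RHS](iotaDl 1 0) -map_comp; apply: eq_map => i /=.
by rewrite add1n addnS addSn.
Qed.

Lemma steps_set_successors sb vs succ :
  steps (set_successors sb vs succ) <= 2 * size sb + 1.
Proof.
elim: sb vs succ => [|y sb IH] [|v vs] succ; rewrite /= !stepsE //; try lia.
by set s' := result _; have := IH vs s'; lia.
Qed.

Lemma nth_set_successors sb vs succ u : uniq (map snd sb) -> size vs = size sb ->
  nth 0 (result (set_successors sb vs succ)) u =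
  if u \in map snd sb then nth 0 vs (index u (map snd sb)) else nth 0 succ u.
Proof.
elim: sb vs succ => [|y sb IH] [|v vs] succ //= /andP[ysb usb] [sz].
rewrite !resultE IH // nth_set_nth /= inE (eq_sym u).
case: (eqVneq y.2 u) => [e|ne] //=; by rewrite -e (negPf ysb).
Qed.

Lemma steps_follow m succ v : steps (follow m succ v) = 2 * m + 1.
Proof. by elim: m v => //= m IH v; rewrite !stepsE IH; lia. Qed.

Lemma result_follow m succ v :
  result (follow m succ v) = traject (nth 0 succ) (nth 0 succ v) m.
Proof. by elim: m v => //= m IH v; rewrite !resultE IH. Qed.

(** * Exchanges *)

Lemma steps_exchange v sel sa sb : steps (exchange v sel sa sb) <= (size sel).+1.
Proof.
elim: sel v sa sb => [|e sel IH] v [|x sa] [|y sb] //=.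
rewrite !stepsE; case: ifP => _; [|case: ifP => _]; rewrite !stepsE;
[have := IH x.2 sa sb | have := IH v sa sb | have := IH x.2 sa sb]; lia.
Qed.

Fixpoint swap_at T k (l : seq T) :=
  match k, l with
  | 0, x :: x' :: l' => x' :: x :: l'
  | k'.+1, x :: l' => x :: swap_at k' l'
  | _, _ => l
  end.

Definition swaps T (l : seq T) ks := foldl (fun l k => swap_at k l) l ks.

Lemma swaps_cons T x (l : seq T) ks : swaps (x :: l) (map succn ks) = x :: swaps l ks.
Proof. by elim: ks l => //= k ks IH l; rewrite IH. Qed.

Lemma nth_swap_at T (x0 : T) k l i : k.+1 < size l ->
  nth x0 (swap_at k l) i =
  nth x0 l (if i == k then k.+1 else if i == k.+1 then k else i).
Proof.
elim: k l i => [|k IH] [|x l] i //=.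
  by case: l => [|x' l] // _; case: i => [|[|i]].
rewrite ltnS => h; case: i => [|i] //=; rewrite IH // !eqSS.
by case: eqP => // _; case: eqP.
Qed.

Lemma perm_swap_at (T : eqType) k (l : seq T) : perm_eq (swap_at k l) l.
Proof.
elim: k l => [|k IH] [|x l] //=; last by rewrite perm_cons.
case: l => [|x' l] //; apply/permP => a /=; lia.
Qed.

(** [ks] is the order in which the exchanges take effect: rank 0 is put before or after all higher
    ranks according to the comparison made by [exchange]. The conclusion retains only its set of
    ranks, which is all that [acyclic_perm] requires. *)
Lemma exchange_swaps v sel sa sb : size sel = size sa -> size sb = size sa ->
  exists ks, let r := result (exchange v sel sa sb) in
    [/\ r.1 :: r.2 = swaps (v :: map snd sa) ks, uniq ks
      & forall k, (k \in ks) = nth false sel k].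
Proof.
elim: sel v sa sb => [|e sel IH] v [|x sa] [|y sb] //=.
  by move=> _ _; exists [::]; split=> // k; rewrite nth_nil.
have memS ks k : (k.+1 \in map succn ks) = (k \in ks).
  by rewrite mem_map // => a b [].
have mem0 ks : (0 \in map succn ks) = false by apply/mapP => -[].
have uniqS ks : uniq (map succn ks) = uniq ks by rewrite map_inj_uniq // => a b [].
move=> [sz1] [sz2]; case: e; rewrite /= !resultE; last first.
  have [ks [h1 h2 h3]] := IH x.2 sa sb sz1 sz2.
  exists (map succn ks); rewrite /= h1 swaps_cons uniqS; split=> //.
  by case=> [|k]; rewrite ?mem0 // memS.
case: ifP => _; rewrite !resultE /=.
  have [ks [h1 h2 h3]] := IH v sa sb sz1 sz2.
  exists (0 :: map succn ks); rewrite /= h1 swaps_cons uniqS mem0; split=> //.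
  by case=> [|k]; rewrite inE //= memS h3.
have [ks [h1 h2 h3]] := IH x.2 sa sb sz1 sz2.
exists (rcons (map succn ks) 0); rewrite rcons_uniq mem0 uniqS; split=> //.
  rewrite /swaps foldl_rcons -/(swaps _ _) swaps_cons -h1 //.
by case=> [|k]; rewrite mem_rcons inE //= memS h3.
Qed.

Section ExchangeCost.
Variable a : nat -> nat.

Fixpoint assign_cost (ys : seq (nat * nat)) (vs : seq nat) :=
  match ys, vs with
  | y :: ys', v :: vs' => (y.1 - a v) + assign_cost ys' vs'
  | _, _ => 0
  end.

Lemma exchange_head v sel sa sb (r := result (exchange v sel sa sb)) :
  r.1 = v \/ r.1 \in map snd sa.
Proof.
rewrite {}/r; elim: sel v sa sb => [|e sel IH] v [|x sa] [|y sb] //=;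
  rewrite ?resultE; try by left.
case: ifP => _; [|case: ifP => _]; rewrite !resultE /=; try by left.
  by right; rewrite inE eqxx.
have [->|h] := IH x.2 sa sb; right; rewrite inE ?eqxx //.
by rewrite h orbT.
Qed.

(* [v], possibly carried over from lower ranks, has the same effect as the
   original successor [x] on the cost of the next exchange. *)
Lemma exchange_cost v sel (x : nat * nat) (sa : seq (nat * nat)) y sb :
  size sel = size sa -> size sb = size sa ->
  (forall z, z \in x :: sa -> a z.2 = z.1) ->
  sorted le_key (x :: sa) -> sorted le_key (y :: sb) ->
  a v <= x.1 -> maxn (a v) y.1 = maxn x.1 y.1 ->
  let r := result (exchange v sel sa sb) in
  assign_cost (y :: sb) (r.1 :: r.2) =
  assign_cost (y :: sb) (v :: map snd sa) +
  \sum_(0 <= k < size sel | nth false sel k) swap_cost (x :: sa) (y :: sb) k.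
Proof.
have sum_shift e sel' (F : nat -> nat) :
    \sum_(0 <= k < (size sel').+1 | nth false (e :: sel') k) F k =
    (if e then F 0 else 0) + \sum_(0 <= k < size sel' | nth false sel' k) F k.+1.
  by rewrite big_mkcond big_nat_recl //= [X in _ = _ + X]big_mkcond.
elim: sel v x sa y sb => [|e sel IH] v x [|x' sa] y [|y' sb] //=.
  by move=> _ _ _ _ _ _ _; rewrite big_geq // !addn0.
move=> [sz1] [sz2] aP /andP[xx' srta] /andP[yy' srtb] av mv.
have aP' z : z \in x' :: sa -> a z.2 = z.1 by move=> h; apply: aP; rewrite inE h orbT.
have ax' : a x'.2 = x'.1 by apply: aP'; rewrite inE eqxx.
rewrite /le_key in xx' yy'.
rewrite sum_shift; set S := \sum_(_ <= _ < _ | _) _.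
have {}IH w : a w <= x'.1 -> maxn (a w) y'.1 = maxn x'.1 y'.1 ->
    let r := result (exchange w sel sa sb) in
    assign_cost (y' :: sb) (r.1 :: r.2) =
    assign_cost (y' :: sb) (w :: map snd sa) + S.
  by move=> aw mw; apply: (IH w x' sa y' sb).
move: S IH => S IH; rewrite /swap_cost /=.
case: e; rewrite /= !resultE; last first.
  by have /= := IH x'.2; rewrite /= ax' => /(_ (leqnn _) erefl) ->; lia.
case: (leqP x'.1 y'.1) => xy; rewrite !resultE /=.
  (* Both [a v] and [x'.1] are at most [y'.1], so [v] can take the place of [x'] at the next rank
     without affecting the maximum there. *)
  have h1 : a v <= x'.1 by apply: leq_trans xx'.
  have h2 : maxn (a v) y'.1 = maxn x'.1 y'.1 by lia.
  by have /= -> := IH v h1 h2; lia.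
have /= := IH x'.2; rewrite /= ax' => /(_ (leqnn _) erefl).
(* The successor handed back is longer than [y'.1], hence than [y.1]: it costs 0 at either rank, and
   the whole change of cost comes from moving [v]. *)
have hd : x'.1 <= a (result (exchange x'.2 sel sa sb)).1.
  have [->|] := exchange_head x'.2 sel sa sb; first by rewrite ax'.
  case/mapP => z zsa ->; rewrite aP' ?inE ?zsa ?orbT //.
  have tr : transitive le_key by move=> ? ? ?; apply: leq_trans.
  by have /allP := order_path_min tr srta; apply.
by move: (result _) hd => -[r1 r2] /=; lia.
Qed.

End ExchangeCost.

(** * Lower bound on assignments *)

Section AssignmentBound.
Variables (n : nat) (A B : nat -> nat) (pi : 'I_n -> 'I_n).
Hypothesis pi_inj : injective pi.
Hypothesis A_mono : forall i j, i <= j -> j < n -> A i <= A j.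
Hypothesis B_mono : forall i j, i <= j -> j < n -> B i <= B j.

Definition crossed k := [exists j : 'I_n, (k < j) && (pi j <= k)].

(** The common bound [M] makes all costs sums over the same levels, so that sums can be exchanged
    and compared level by level. *)
Lemma sub_levels x y M : x <= M -> x - y = \sum_(t < M) ((y <= t) && (t < x)).
Proof.
have -> : \sum_(t < M) ((y <= t) && (t < x)) = minn x M - y; last by lia.
elim: M => [|M IH]; first by rewrite big_ord0; lia.
rewrite big_ord_recr /= IH.
by case: (leqP y M); case: (ltnP M x) => /=; lia.
Qed.

(** If [t] separates the ranks up to a crossed [k0] from the others in both [A] and [B], the first
    sum vanishes, the second is at most 1 because [k0] is unique, and a node crossing [k0] makes the
    right side positive. Otherwise the second sum vanishes and counting suffices. *)
Lemma level_bound t :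
  \sum_(k < n) ((A k <= t) && (t < B k)) +
  \sum_(0 <= k < n.-1 | crossed k)
    ((maxn (A k) (B k) <= t) && (t < minn (A k.+1) (B k.+1))) <=
  \sum_(k < n) ((A (pi k) <= t) && (t < B k)).
Proof.
pose cond k := (maxn (A k) (B k) <= t) && (t < minn (A k.+1) (B k.+1)).
case: (boolP (has (fun k => crossed k && cond k) (iota 0 n.-1))) => [|/hasPn none].
  case/hasP => k0; rewrite mem_iota => k0n /andP[cr cond0].
  have side i : i < n -> (A i <= t) = (i <= k0) /\ (B i <= t) = (i <= k0).
    move=> ltin; move: cond0; rewrite /cond; case: (leqP i k0) => h.
      by have := A_mono h; have := B_mono h; lia.
    by have := A_mono h ltin; have := B_mono h ltin; lia.
  rewrite big1 ?add0n => [|k _]; last first.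
    by have [-> e] := side k (ltn_ord k); rewrite ltnNge e andbN.
  apply: (@leq_trans 1); last first.
    case/existsP: cr => j /andP[kj pj]; rewrite (bigD1 j) //=.
    have [-> _] := side _ (ltn_ord (pi j)); have [_ e] := side _ (ltn_ord j).
    by rewrite (ltnNge t) e -ltnNge kj pj.
  apply: (@leq_trans (\sum_(k <- iota 0 n.-1) (k == k0))).
    rewrite /index_iota subn0 big_mkcond big_seq [X in _ <= X]big_seq.
    apply: leq_sum => k; rewrite mem_iota => kn; case: ifP => _ //.
    have [e1 _] := side k ltac:(lia); have [e2 _] := side k.+1 ltac:(lia).
    by case: (eqVneq k k0) => /=; lia.
  have -> : \sum_(k <- iota 0 n.-1) (k == k0) = count_mem k0 (iota 0 n.-1).
    by rewrite -sum1_count [RHS]big_mkcond; apply: eq_bigr => k _ /=; case: (k == k0).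
  by rewrite count_uniq_mem ?iota_uniq // leq_b1.
rewrite [X in _ + X]big1_seq ?addn0 => [|k /andP[cr]]; last first.
  rewrite /index_iota subn0 => /none; rewrite cr /= -/(cond k).
  by case: (cond k).
(* If such an [i] exists, [B k <= t] implies [A k <= t]. Adding the number of [k] with [B k <= t] to
   both sides turns the left one into the number of [k] with [A k <= t], which [pi] preserves. *)
case: (boolP [exists i : 'I_n, (A i <= t) && (t < B i)]) => [|/existsPn none'].
  case/existsP => i /andP[Ai Bi].
  have incl (k : 'I_n) : B k <= t -> A k <= t.
    move=> Bk; case: (leqP k i) => h; first exact: leq_trans (A_mono h _) Ai.
    have := B_mono (ltnW h) (ltn_ord k); lia.
  rewrite -(leq_add2r (\sum_(k < n) (B k <= t))) -!big_split /=.
  rewrite (eq_bigr (fun k : 'I_n => (A k <= t) : nat)); last first.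
    move=> k _; have := incl k; rewrite (ltnNge t); case: (B k <= t) => [->|_] //.
    by rewrite andbT addn0.
  rewrite (reindex_inj pi_inj) /=; apply: leq_sum => k _.
  by rewrite (ltnNge t); case: (A _ <= t) => //; case: (B k <= t).
by rewrite big1 // => k _; have := none' k => /negPf ->.
Qed.

Lemma assignment_bound :
  \sum_(k < n) (B k - A k) +
  \sum_(0 <= k < n.-1 | crossed k) (minn (A k.+1) (B k.+1) - maxn (A k) (B k)) <=
  \sum_(k < n) (B k - A (pi k)).
Proof.
pose M := \sum_(k < n) B k.
have BM k : k < n -> B k <= M.
  by move=> kn; rewrite /M (bigD1 (Ordinal kn)) //= leq_addr.
rewrite (eq_bigr (fun k : 'I_n => \sum_(t < M) ((A k <= t) && (t < B k)))); last first.
  by move=> k _; apply: sub_levels; apply: BM.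
rewrite [X in _ <= X](eq_bigr (fun k : 'I_n =>
  \sum_(t < M) ((A (pi k) <= t) && (t < B k)))); last first.
  by move=> k _; apply: sub_levels; apply: BM.
rewrite [X in _ + X]big_seq_cond [X in _ + X](eq_bigr (fun k => \sum_(t < M)
  ((maxn (A k) (B k) <= t) && (t < minn (A k.+1) (B k.+1))))); last first.
  move=> k /andP[]; rewrite mem_index_iota => kn _; apply: sub_levels.
  by have := BM k.+1; lia.
rewrite -big_seq_cond exchange_big /= [X in _ + X]exchange_big /=.
rewrite [X in _ <= X]exchange_big -big_split /=; apply: leq_sum => t _.
exact: level_bound.
Qed.

(** What goes up must come down: otherwise [pi] would map the ranks above [j] together with [k]
    injectively into the ranks above [j]. *)
Lemma crossed_up (k : 'I_n) j : k <= j -> j < pi k -> crossed j.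
Proof.
move=> kj jp; rewrite /crossed; case: (boolP [exists i, _]) => // /existsPn none.
pose D := [set i : 'I_n | j < i].
have kD : k \notin D by rewrite inE -leqNgt.
have : #|pi @: (k |: D)| <= #|D|.
  apply: subset_leq_card; apply/subsetP => i /imsetP[i' + ->].
  rewrite !inE => /orP[/eqP ->//|ji']; have := none i'.
  by rewrite ji' /= -ltnNge.
by rewrite card_imset // cardsU1 kD; lia.
Qed.

Lemma crossed_connect (F : rel nat) (y : nat -> nat) : is_equiv F ->
  (forall k, k < n.-1 -> crossed k -> F (y k) (y k.+1)) ->
  forall k : 'I_n, F (y k) (y (pi k)).
Proof.
move=> [rF sF tF] eF.
have chain i j : i <= j -> (forall k, i <= k < j -> F (y k) (y k.+1)) -> F (y i) (y j).
  elim: j => [|j IH]; first by rewrite leqn0 => /eqP ->.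
  rewrite leq_eqVlt => /orP[/eqP -> //|ij] h.
  apply: tF (h j _); last by lia.
  by apply: IH => // k kj; apply: h; lia.
move=> k; case: (leqP k (pi k)) => h.
  apply: chain => // j jk; apply: eF; first by have := ltn_ord (pi k); lia.
  by apply: (@crossed_up k); lia.
rewrite sF; apply: chain => [|j jk]; first exact: ltnW.
apply: eF; first by have := ltn_ord k; lia.
by apply/existsP; exists k; lia.
Qed.

End AssignmentBound.

(** * Tours *)

(** The final [b v] is the arc back to the dummy node, whose [a] is 0. *)
Fixpoint tour_cost (a b : nat -> nat) v vs :=
  if vs is w :: vs' then (b v - a w) + tour_cost a b w vs' else b v.

Lemma tour_cost_sum (a b : nat -> nat) (g : nat -> nat) v vs : a 0 = 0 ->
  fpath g v vs -> g (last v vs) = 0 ->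
  tour_cost a b v vs = \sum_(x <- v :: vs) (b x - a (g x)).
Proof.
move=> a0; elim: vs v => [|w vs IH] v /=.
  by move=> _ gv; rewrite big_seq1 gv a0 subn0.
by move=> /andP[/eqP gv pw] gl; rewrite big_cons gv IH.
Qed.

Lemma assign_costE a ys vs : size vs = size ys ->
  assign_cost a ys vs =
  \sum_(k < size ys) ((nth (0, 0) ys k).1 - a (nth 0 vs k)).
Proof.
elim: ys vs => [|y ys IH] [|v vs] //=; first by rewrite big_ord0.
by move=> [sz]; rewrite big_ord_recl IH.
Qed.

Section Tours.
Variables (m : nat) (a b : nat -> nat).
Let N := m.+1.
Variables (sa sb : seq (nat * nat)).
Hypothesis a0 : a 0 = 0.
Hypothesis sa_perm : perm_eq sa [seq (a v, v) | v <- iota 0 N].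
Hypothesis sb_perm : perm_eq sb [seq (b v, v) | v <- iota 0 N].
Hypothesis sa_sorted : sorted le_key sa.
Hypothesis sb_sorted : sorted le_key sb.
Let na := map snd sa.
Let nb := map snd sb.
Let y k := (nth (0, 0) sb k).2.

Lemma size_sa : size sa = N.
Proof. by rewrite (perm_size sa_perm) size_map size_iota. Qed.
Lemma size_sb : size sb = N.
Proof. by rewrite (perm_size sb_perm) size_map size_iota. Qed.

Lemma na_perm : perm_eq na (iota 0 N).
Proof. by rewrite (perm_trans (perm_map snd sa_perm)) // -map_comp map_id. Qed.
Lemma nb_perm : perm_eq nb (iota 0 N).
Proof. by rewrite (perm_trans (perm_map snd sb_perm)) // -map_comp map_id. Qed.

Lemma sa_key z : z \in sa -> a z.2 = z.1.
Proof. by rewrite (perm_mem sa_perm) => /mapP[v _ ->]. Qed.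
Lemma sb_key z : z \in sb -> b z.2 = z.1.
Proof. by rewrite (perm_mem sb_perm) => /mapP[v _ ->]. Qed.

Lemma mem_nb u : (u \in nb) = (u < N).
Proof. by rewrite (perm_mem nb_perm) mem_iota. Qed.
Lemma mem_na u : (u \in na) = (u < N).
Proof. by rewrite (perm_mem na_perm) mem_iota. Qed.
Lemma uniq_nb : uniq nb.
Proof. by rewrite (perm_uniq nb_perm) iota_uniq. Qed.
Lemma size_nb : size nb = N. Proof. by rewrite size_map size_sb. Qed.
Lemma size_na : size na = N. Proof. by rewrite size_map size_sa. Qed.

Lemma nth_nb k : k < N -> nth 0 nb k = y k.
Proof. by move=> kN; rewrite (nth_map (0, 0)) // size_sb. Qed.
Lemma y_lt k : k < N -> y k < N.
Proof. by move=> kN; rewrite -nth_nb // -mem_nb mem_nth // size_nb. Qed.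
Lemma index_nb k : k < N -> index (y k) nb = k.
Proof. by move=> kN; rewrite -nth_nb // index_uniq ?uniq_nb ?size_nb. Qed.

Lemma index_nb_lt u : u < N -> index u nb < N.
Proof. by rewrite -mem_nb -index_mem size_nb. Qed.

Lemma index_na_lt u : u < N -> index u na < N.
Proof. by rewrite -mem_na -index_mem size_na. Qed.

(** [l] lists successors by the rank of their node in [sb], so that exchanges act on adjacent
    entries; the finite type gives access to [fconnect]. *)
Definition succ_of (l : seq nat) (u : 'I_N) : 'I_N := inord (nth 0 l (index (val u) nb)).

Lemma val_succ_of l u : perm_eq l (iota 0 N) ->
  val (succ_of l u) = nth 0 l (index (val u) nb).
Proof.
move=> pl; rewrite /= inordK // -/N; set i := index _ _.
have iN : i < size l.
  by rewrite (perm_size pl) size_iota; apply: index_nb_lt (ltn_ord u).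
by have := mem_nth 0 iN; rewrite (perm_mem pl) mem_iota => /andP[].
Qed.

Lemma succ_of_inj l : perm_eq l (iota 0 N) -> injective (succ_of l).
Proof.
move=> pl u v /(congr1 val); rewrite !val_succ_of // => /eqP.
rewrite /= nth_uniq ?(perm_uniq pl) ?iota_uniq ?(perm_size pl) ?size_iota ?index_nb_lt //.
move=> /eqP h; apply: val_inj.
by have /= := congr1 (nth 0 nb) h; rewrite !nth_index ?mem_nb ?ltn_ord.
Qed.

Definition orbit_rel (l : seq nat) : rel nat :=
  fun u v => fconnect (succ_of l) (inord u) (inord v).

Lemma orbit_rel_equiv l : perm_eq l (iota 0 N) -> is_equiv (orbit_rel l).
Proof.
move=> pl; have [r s t] := fconnect_equiv (succ_of_inj pl).
by split=> [u|u v|v u w]; rewrite /orbit_rel //; apply: t.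
Qed.

Lemma succ_of_swap l k : perm_eq l (iota 0 N) -> k < m ->
  succ_of (swap_at k l) =1 swapped (succ_of l) (inord (y k)) (inord (y k.+1)).
Proof.
move=> pl km u.
have pl' : perm_eq (swap_at k l) (iota 0 N) by apply: perm_trans (perm_swap_at _ _) pl.
have k1 : k < N by apply: ltnW.
have vy j : j < N -> val (inord (y j) : 'I_N) = y j by move=> jN; rewrite /= inordK ?y_lt.
have eqy j : j < N -> (u == inord (y j)) = (index (val u) nb == j).
  move=> jN; rewrite -val_eqE vy //; apply/eqP/eqP => [->|<-]; first exact: index_nb.
  by rewrite /= -(nth_nb (index_nb_lt (ltn_ord u))) nth_index // mem_nb.
apply: val_inj; rewrite val_succ_of // nth_swap_at; last first.
  by rewrite (perm_size pl) size_iota.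
rewrite /swapped !eqy // val_succ_of //; congr nth.
case: eqP => _; first by rewrite vy // index_nb.
by case: eqP => _ //; rewrite vy // index_nb.
Qed.

(** Acyclicity ensures that each exchange, when its turn comes, joins two distinct cycles, as
    [fconnect_swapped] demands. *)
Lemma orbit_rel_swaps l ks : perm_eq l (iota 0 N) -> all (gtn m) ks ->
  acyclic y (orbit_rel l) ks ->
  perm_eq (swaps l ks) (iota 0 N) /\
  {in gtn N &, orbit_rel (swaps l ks) =2 merges y (orbit_rel l) ks}.
Proof.
elim: ks l => [|k ks IH] l pl //= /andP[km ksm] /andP[ac acs].
have pl' : perm_eq (swap_at k l) (iota 0 N) by apply: perm_trans (perm_swap_at _ _) pl.
have e : orbit_rel (swap_at k l) =2 merge_at (orbit_rel l) (y k) (y k.+1).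
  move=> u v; rewrite /orbit_rel (eq_fconnect (succ_of_swap pl km)).
  by rewrite fconnect_swapped //; apply: succ_of_inj.
have [|h1 h2] := IH _ pl' ksm; first by rewrite (eq_acyclic _ _ e).
split=> // u v uN vN; rewrite -/(swaps _ _) h2 //.
exact: eq_merges.
Qed.

Lemma rank_ind (F : rel nat) : is_equiv F ->
  (forall k, k < m -> F (y k) (y k.+1)) -> {in gtn N &, forall u v, F u v}.
Proof.
move=> [rF sF tF] h.
have F0 k : k < N -> F (y 0) (y k).
  by elim: k => // k IH kN; apply: tF (IH (ltnW kN)) (h _ _).
have Fu u : u < N -> F (y 0) u.
  move=> uN; have := F0 _ (index_nb_lt uN).
  by rewrite -(nth_nb (index_nb_lt uN)) nth_index // mem_nb.
move=> u v uN vN; apply: tF (Fu _ vN); rewrite sF; exact: Fu.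
Qed.

Lemma assign_cost_ranks :
  assign_cost a sb na = \sum_(k < N) ((nth (0, 0) sb k).1 - (nth (0, 0) sa k).1).
Proof.
rewrite assign_costE ?size_na ?size_sb //; apply: eq_bigr => k _.
by rewrite (nth_map (0, 0)) ?size_sa // sa_key // mem_nth // size_sa.
Qed.

Variable es : seq (nat * nat).
Hypothesis es_perm : perm_eq es [seq (swap_cost sa sb i, i) | i <- iota 0 m].
Hypothesis es_sorted : sorted le_key es.
Let T := greedy y (orbit_rel na) (map snd es).

Lemma es_ranks : perm_eq (map snd es) (iota 0 m).
Proof. by rewrite (perm_trans (perm_map snd es_perm)) // -map_comp map_id. Qed.

(** The second hypothesis says that [g] is a single cycle. It is applied to the equivalence
    generated by the assignment and the crossed ranks, which therefore compete with the greedy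
    tree. *)
Lemma tour_lower_bound (g : 'I_N -> 'I_N) : injective g ->
  (forall F : rel nat, is_equiv F -> (forall u : 'I_N, F u (g u)) ->
    {in gtn N &, forall u v, F u v}) ->
  assign_cost a sb na + \sum_(k <- T) swap_cost sa sb k <=
  \sum_(u < N) (b u - a (g u)).
Proof.
move=> injg conn.
pose A k := (nth (0, 0) sa k).1; pose B k := (nth (0, 0) sb k).1.
pose yo (k : 'I_N) : 'I_N := inord (y k).
have vyo k : val (yo k) = y k by rewrite /= inordK ?y_lt.
have yo_inj : injective yo.
  move=> k k' /(congr1 val); rewrite !vyo => /(congr1 (index^~ nb)).
  by rewrite !index_nb // => /val_inj.
(* [g] read between ranks: from the rank of a node in [sb] to the rank of its successor in [sa]. The
   assignment itself becomes the identity. *)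
pose pi (k : 'I_N) : 'I_N := inord (index (val (g (yo k))) na).
have vpi k : val (pi k) = index (val (g (yo k))) na.
  by rewrite /= inordK //; apply: index_na_lt (ltn_ord _).
have napi k : nth 0 na (pi k) = g (yo k).
  by rewrite [nat_of_ord _]vpi nth_index // mem_na; apply: ltn_ord.
have pi_inj : injective pi.
  move=> k k' e; apply/yo_inj/injg/val_inj; by rewrite /= -!napi e.
have tr : transitive le_key by move=> ? ? ?; apply: leq_trans.
have rf : reflexive le_key by move=> ?; apply: leqnn.
have Amono i j : i <= j -> j < N -> A i <= A j.
  by move=> ij jN; apply: (sorted_leq_nth tr rf (0, 0) sa_sorted);
     rewrite ?inE ?size_sa //; apply: leq_ltn_trans jN.
have Bmono i j : i <= j -> j < N -> B i <= B j.
  by move=> ij jN; apply: (sorted_leq_nth tr rf (0, 0) sb_sorted);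
     rewrite ?inE ?size_sb //; apply: leq_ltn_trans jN.
have := assignment_bound pi_inj Amono Bmono.
rewrite -assign_cost_ranks [X in _ <= X -> _](_ : _ = \sum_(u < N) (b u - a (g u))).
  apply: leq_trans; rewrite leq_add2l.
  rewrite -[X in _ <= X]big_filter /index_iota subn0 [N.-1]/=.
  set K := filter _ _.
  have KP k : k \in K = (k < m) && crossed pi k.
    by rewrite mem_filter mem_iota andbC.
  have eE := orbit_rel_equiv na_perm.
  apply: (@greedy_min _ y (gtn N)) => //.
  - by move=> k; rewrite (perm_mem es_ranks) mem_iota => km; split; apply: y_lt; lia.
  - rewrite -map_comp (_ : map _ es = map fst es) ?sorted_map //.
    apply/eq_in_map => e; rewrite (perm_mem es_perm) => /mapP[i _ ->] //.
  - by rewrite (perm_uniq es_ranks) iota_uniq.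
  - by rewrite filter_uniq ?iota_uniq.
  - by move=> k; rewrite KP (perm_mem es_ranks) mem_iota => /andP[].
  - have eF := merges_equiv y K eE; case: (eF) => rF sF tF.
    apply: conn => // u.
    pose k : 'I_N := Ordinal (index_nb_lt (ltn_ord u)).
    have yk : yo k = u.
      apply: val_inj; rewrite vyo -nth_nb ?index_nb_lt //=.
      by rewrite nth_index // mem_nb.
    have : merges y (orbit_rel na) K (y k) (y (pi k)).
      apply: (@crossed_connect _ pi pi_inj _ y eF) => j jm cj.
      by apply: merges_edge => //; rewrite KP jm cj.
    (* Crossed ranks lead from [u] to the node of rank [pi k] in [sb], and the assignment sends that
       node to [g u]. *)
    rewrite -[y k]vyo yk => h; apply: tF h _; apply: merges_sub.
    rewrite /orbit_rel; have -> : inord (g u) = succ_of na (inord (y (pi k))).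
      apply: val_inj; rewrite val_succ_of ?na_perm // /= inord_val inordK ?y_lt //.
      by rewrite index_nb // napi yk.
    exact: fconnect1.
rewrite [RHS](reindex_inj yo_inj); apply: eq_bigr => k _; congr (_ - _).
  by rewrite [nat_of_ord (yo k)]vyo sb_key // mem_nth // size_sb.
have := napi k; rewrite (nth_map (0, 0)) ?size_sa // => <-.
by rewrite sa_key // mem_nth // size_sa.
Qed.

Variable sel : seq bool.
Hypothesis size_sel : size sel = m.
Hypothesis selP : forall k, nth false sel k = (k \in T).
Let r := result (exchange (head (0, 0) sa).2 sel (behead sa) (behead sb)).
Let l := r.1 :: r.2.

Lemma T_lt k : k \in T -> k < m.
Proof.
move=> /(mem_subseq (greedy_subseq _ _ _)).
by rewrite (perm_mem es_ranks) mem_iota.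
Qed.

Lemma T_uniq : uniq T.
Proof.
apply: subseq_uniq (greedy_subseq _ _ _) _.
by rewrite (perm_uniq es_ranks) iota_uniq.
Qed.

(** All pairs of consecutive ranks together connect everything, the greedy selection spans as much,
    and performing it in the order of [exchange] merges the same cycles. *)
Lemma exchange_total :
  perm_eq l (iota 0 N) /\ {in gtn N &, forall u v, orbit_rel l u v}.
Proof.
have szb : size (behead sb) = size (behead sa) by rewrite !size_behead size_sa size_sb.
have szs : size sel = size (behead sa) by rewrite size_sel size_behead size_sa.
have [ks [lE uks ksP]] := exchange_swaps (head (0, 0) sa).2 szs szb.
have naE : (head (0, 0) sa).2 :: map snd (behead sa) = na.
  by rewrite /na; have := size_sa; case: (sa).
rewrite naE -/r -/l in lE.
have pks : perm_eq T ks.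
  by apply: uniq_perm => //; [exact: T_uniq | move=> k; rewrite ksP selP].
have eE := orbit_rel_equiv na_perm.
have [||pl tot] := @orbit_rel_swaps na ks na_perm.
- by apply/allP => k; rewrite -(perm_mem pks) => /T_lt.
- by rewrite -(acyclic_perm y eE pks) greedy_acyclic.
rewrite lE; split=> // u v uN vN; rewrite tot //.
apply: (@merges_mono _ y (orbit_rel na) (orbit_rel na) T) => //.
  by move=> k; rewrite (perm_mem pks).
apply: greedy_merges => //; apply: rank_ind => //; first exact: merges_equiv.
by move=> k km; apply: merges_edge; rewrite ?(perm_mem es_ranks) ?mem_iota.
Qed.

Lemma exchange_total_cost :
  assign_cost a sb l = assign_cost a sb na + \sum_(k <- T) swap_cost sa sb k.
Proof.
rewrite /l /r /na; have := size_sa; have := size_sb.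
have saK := sa_key; have srta := sa_sorted; have srtb := sb_sorted.
rewrite (_ : \sum_(k <- T) swap_cost sa sb k =
  \sum_(0 <= k < size sel | nth false sel k) swap_cost sa sb k); last first.
  rewrite -[RHS]big_filter; apply: perm_big; apply: uniq_perm; first exact: T_uniq.
    by rewrite filter_uniq // iota_uniq.
  move=> k; rewrite mem_filter selP mem_index_iota size_sel.
  by case: (boolP (k \in T)) => // /T_lt ->.
case: (sa) saK srta => [|x sa'] // saK srta.
case: (sb) srtb => [|z sb'] // srtb [szb] [sza].
(* At rank 0 nothing has been carried over: [v] is the original successor, and the invariant on it
   is trivial. *)
apply: exchange_cost => //; rewrite ?size_sel ?sza ?szb //.
  by rewrite saK ?mem_head.
by rewrite saK ?mem_head.
Qed.

Variable succ : seq nat.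
Hypothesis succP : forall u, u < N -> nth 0 succ u = nth 0 l (index u nb).
Let g := nth 0 succ.
Let vs := traject g (g 0) m.

Lemma follow_tour :
  [/\ perm_eq (0 :: vs) (iota 0 N), fpath g 0 vs & g (last 0 vs) = 0].
Proof.
have [pl tot] := exchange_total.
pose f := succ_of l.
have fg u : val (f u) = g (val u) by rewrite val_succ_of // /g succP //; apply: ltn_ord.
have fgi i u : val (iter i f u) = iter i g (val u).
  by elim: i => // i IH; rewrite !iterS fg IH.
have tr n u : map val (traject f u n) = traject g (val u) n.
  by elim: n u => // n IH u; rewrite !trajectS map_cons IH fg.
have conn u : fconnect f ord0 u.
  have := tot 0 u (ltn0Sn _) (ltn_ord u); rewrite /orbit_rel inord_val.
  by rewrite (_ : inord 0 = ord0) //; apply: val_inj; rewrite /= inordK.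
(* The orbit of the dummy node is everything, so following successors from it lists every job once
   and returns to it. *)
have ord : order f ord0 = N.
  by rewrite /order -[RHS]card_ord; apply: eq_card => u; rewrite [LHS]conn.
split.
- rewrite (_ : 0 :: vs = map val (orbit f ord0)); last by rewrite /orbit ord tr.
  rewrite -val_enum_ord; apply: perm_map.
  apply: uniq_perm; rewrite ?orbit_uniq ?enum_uniq //.
  by move=> u; rewrite -fconnect_orbit conn mem_enum.
- exact: fpath_traject.
- have := iter_order (succ_of_inj pl) ord0; rewrite -/f ord => fN.
  by rewrite last_traject -[g _]/(iter N g 0) -(fgi N ord0) fN.
Qed.

Lemma follow_min vs' : perm_eq vs' (iota 1 m) ->
  tour_cost a b 0 vs <= tour_cost a b 0 vs'.
Proof.
move=> pvs'; have [pvs pg gl] := follow_tour; have [pl _] := exchange_total.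
rewrite (tour_cost_sum b a0 pg gl) (perm_big _ pvs) -(perm_big _ nb_perm) /=.
have -> : \sum_(x <- nb) (b x - a (g x)) = assign_cost a sb l.
  rewrite assign_costE; last by rewrite (perm_size pl) size_iota size_sb.
  rewrite (big_nth 0) size_nb size_sb big_mkord; apply: eq_bigr => k _.
  rewrite /g succP nth_nb ?y_lt // index_nb //.
  by rewrite sb_key // mem_nth // size_sb.
rewrite exchange_total_cost.
(* The competitor is closed into a cycle through the dummy node, and [next c] is its successor
   map. *)
set c := 0 :: vs'; have pc : perm_eq c (iota 0 N) by rewrite /c /= perm_cons.
have uc : uniq c by rewrite (perm_uniq pc) iota_uniq.
have cc : fcycle (next c) c by apply: cycle_next.
have : fpath (next c) 0 (rcons vs' 0) by exact: cc.
rewrite rcons_path => /andP[pv /eqP nl].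
rewrite (tour_cost_sum b a0 pv nl) (perm_big _ pc) -[iota 0 N]/(index_iota 0 N) big_mkord.
pose h (u : 'I_N) : 'I_N := inord (next c u).
have mc u : (u \in c) = (u < N) by rewrite (perm_mem pc) mem_iota.
have vh u : val (h u) = next c u.
  by rewrite /= inordK // -[_ < _]mc mem_next mc.
have -> : \sum_(u < N) (b u - a (next c u)) = \sum_(u < N) (b u - a (h u)).
  by apply: eq_bigr => u _; rewrite -vh.
apply: tour_lower_bound.
  move=> u v /(congr1 val); rewrite !vh => /(congr1 (prev c)).
  by rewrite !prev_next // => /val_inj.
move=> F [rF sF tF] Fh.
suff F0 u : u \in c -> F 0 u.
  move=> u v uN vN; apply: (tF 0); last by rewrite F0 ?mc.
  by rewrite sF F0 ?mc.
have Fn v : v \in c -> F v (next c v).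
  by rewrite mc => vN; have := Fh (Ordinal vN); rewrite vh.
have stay v w : v \in c -> F 0 v -> fpath (next c) v w -> {subset v :: w <= F 0}.
  elim: w v => [|w ws IH] v vc Fv.
    by move=> _ x; rewrite inE => /eqP ->.
  move=> /andP[/eqP nv pw] x; rewrite inE => /orP[/eqP -> //|].
  have wc : w \in c by rewrite -nv mem_next.
  by apply: (IH w wc _ pw); rewrite -nv; apply: tF Fv (Fn _ vc).
by move=> uc'; apply: (stay 0 vs' (mem_head _ _) (rF 0) pv).
Qed.

End Tours.

(** * The Gilmore-Gomory algorithm *)

Section GilmoreGomory.
Variable js : seq (nat * job).
Let m := size js.
Let N := m.+1.
Let d := (0, Job 0 0 0).

Definition node v : nat * job := nth d (d :: js) v.
Let a v := len1 (node v).2.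
Let b v := len2 (node v).2.

Let sa := result (msort ((0, 0) :: result (keys len1 1 js))).
Let sb := result (msort ((0, 0) :: result (keys len2 1 js))).
Let q0 := result (singletons N 0).
Let q := result (assignment_cycles sa sb q0).
Let es := result (msort (result (exchange_costs 0 sa sb))).
Let sel := result (kruskal sb es q (nseq m false)).
Let r := result (exchange (head (0, 0) sa).2 sel (behead sa) (behead sb)).
Let succ := result (set_successors sb (r.1 :: r.2) (nseq N 0)).
Let vs := result (follow m succ 0).

Lemma gg_result L :
  result (gilmore_gomory L js) = result (timetable L js 0 (Job 0 0 0) vs).
Proof. by rewrite /gilmore_gomory 15!result_bind result_length !result_amake. Qed.

Lemma node_keys f : f (Job 0 0 0) = 0 ->
  (0, 0) :: result (keys f 1 js) = [seq (f (node v).2, v) | v <- iota 0 N].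
Proof.
move=> f0; rewrite result_keys /= f0; congr cons.
by rewrite (iotaDl 1 0) -map_comp; apply: eq_map.
Qed.

Lemma gg_sa_perm : perm_eq sa [seq (a v, v) | v <- iota 0 N].
Proof. by rewrite -(@node_keys len1) // perm_msort. Qed.
Lemma gg_sb_perm : perm_eq sb [seq (b v, v) | v <- iota 0 N].
Proof. by rewrite -(@node_keys len2) // perm_msort. Qed.
Let sa_sorted : sorted le_key sa. Proof. exact: sorted_msort. Qed.
Let sb_sorted : sorted le_key sb. Proof. exact: sorted_msort. Qed.
Let size_sa' : size sa = N. Proof. exact: size_sa gg_sa_perm. Qed.
Let size_sb' : size sb = N. Proof. exact: size_sb gg_sb_perm. Qed.

Lemma gg_es_perm : perm_eq es [seq (swap_cost sa sb i, i) | i <- iota 0 m].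
Proof.
rewrite (perm_trans (perm_msort _)) // result_exchange_costs ?size_sa' ?size_sb' //.
Qed.
Let es_sorted : sorted le_key es. Proof. exact: sorted_msort. Qed.

(** One inclusion is minimality, each pair of the zip being an arc of the assignment; the other
    walks along an orbit, one pair of the zip per step. *)
Lemma gg_cycles : partition_wf N q /\
  {in gtn N &, same q =2 orbit_rel m sb (map snd sa)}.
Proof.
have [wf0 same0] := singletons_spec N.
have allN s : perm_eq s (iota 0 N) -> all (gtn N) s.
  by move=> ps; apply/allP => u; rewrite (perm_mem ps) mem_iota.
have pna := na_perm gg_sa_perm; have pnb := nb_perm gg_sb_perm.
have [wfq _ edges mini _] := assignment_cycles_spec wf0 (allN _ pna) (allN _ pnb).
have eE := orbit_rel_equiv gg_sb_perm pna; split=> // u v uN vN.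
have [rE sE tE] := eE; have [rS sS tS] := same_equiv q.
have szz : size (map snd sb) = size (map snd sa) by rewrite !size_map size_sa' size_sb'.
apply/idP/idP.
  apply: mini => //.
    by move=> x y xN yN; rewrite same0 // => /eqP ->.
  move=> e /(nthP (0, 0))[k]; rewrite size_zip -szz minnn size_map size_sb' => kN <-.
  rewrite nth_zip //= /orbit_rel.
  have yN : nth 0 (map snd sb) k < N.
    by rewrite -(mem_nb gg_sb_perm) mem_nth // size_map size_sb'.
  have -> : @inord m (nth 0 (map snd sa) k) =
      succ_of sb (map snd sa) (inord (nth 0 (map snd sb) k)).
    rewrite /succ_of /= inordK // index_uniq //.
      by rewrite size_map size_sb'.
    exact: uniq_nb gg_sb_perm.
  exact: fconnect1.
rewrite /orbit_rel => /iter_findex.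
set f := succ_of _ _; move: (findex _ _ _) => i /(congr1 val) /=.
rewrite [RHS]inordK // => <-.
have : same q u (inord u : 'I_N) by rewrite inordK.
move: (inord u) => w; elim: i w => [//|i IH] w uw; rewrite iterSr; apply: IH.
apply: tS uw _; rewrite (val_succ_of gg_sb_perm _ pna).
set k := index _ _; have kN : k < N by apply: (index_nb_lt gg_sb_perm) (ltn_ord w).
have wE : w = nth 0 (map snd sb) k :> nat.
  by rewrite nth_index // (mem_nb gg_sb_perm); apply: ltn_ord.
suff : (val w, nth 0 (map snd sa) k) \in zip (map snd sb) (map snd sa) by move/edges.
rewrite /= wE -nth_zip // mem_nth // size_zip -szz minnn size_map size_sb' //.
Qed.

Let y k := (nth (0, 0) sb k).2.

Let esN k : k \in map snd es -> y k < N /\ y k.+1 < N.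
Proof.
rewrite (perm_mem (es_ranks gg_es_perm)) mem_iota => km.
by split; apply: (y_lt gg_sb_perm); rewrite ltnS //; apply: ltnW.
Qed.

Let selP k :
  nth false sel k = (k \in greedy y (orbit_rel m sb (map snd sa)) (map snd es)).
Proof.
have [wfq sq] := gg_cycles.
rewrite (kruskal_spec _ wfq esN) nth_nseq if_same /=.
congr (_ \in _); exact: eq_in_greedy sq esN.
Qed.

Let size_sel' : size sel = m.
Proof.
rewrite size_kruskal ?size_nseq //; apply/allP => k.
by rewrite (perm_mem (es_ranks gg_es_perm)) mem_iota.
Qed.

Let exch := exchange_total gg_sa_perm gg_sb_perm gg_es_perm size_sel' selP.

Let succP u : u < N -> nth 0 succ u = nth 0 (r.1 :: r.2) (index u (map snd sb)).
Proof.
move=> uN; have [pl _] := exch.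
rewrite nth_set_successors ?(mem_nb gg_sb_perm) ?uN //.
  exact: uniq_nb gg_sb_perm.
by rewrite (perm_size pl) size_iota size_sb'.
Qed.

Lemma gg_tour : perm_eq vs (iota 1 m) /\ forall vs', perm_eq vs' (iota 1 m) ->
  tour_cost a b 0 vs <= tour_cost a b 0 vs'.
Proof.
rewrite /vs result_follow; split; last first.
  move=> vs' pvs'.
  exact: (follow_min _ gg_sa_perm gg_sb_perm sa_sorted sb_sorted gg_es_perm es_sorted
           size_sel' selP succP).
have [+ _ _] := follow_tour gg_sa_perm gg_sb_perm gg_es_perm size_sel' selP succP.
by rewrite perm_cons.
Qed.

Lemma gg_optimal_tour L : exists ws, [/\ perm_eq ws (iota 1 (size js)),
    result (gilmore_gomory L js) = result (timetable L js 0 (Job 0 0 0) ws)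
  & forall ws', perm_eq ws' (iota 1 (size js)) ->
    tour_cost (fun v => len1 (node v).2) (fun v => len2 (node v).2) 0 ws <=
    tour_cost (fun v => len1 (node v).2) (fun v => len2 (node v).2) 0 ws'].
Proof. by have [? ?] := gg_tour; exists vs; split=> //; apply: gg_result. Qed.

Lemma steps_timetable L t x ws : steps (timetable L js t x ws) = 2 * size ws + 1.
Proof. by elim: ws t x => //= w ws IH t x; rewrite !stepsE IH; lia. Qed.

Lemma steps_gilmore_gomory L K : N <= 2 ^ K ->
  steps (gilmore_gomory L js) <= 50 * N + 8 * (N * K).
Proof.
move=> NK; rewrite /gilmore_gomory.
have [wf0 same0] := singletons_spec N.
have allN s : perm_eq s (iota 0 N) -> all (gtn N) s.
  by move=> ps; apply/allP => u; rewrite (perm_mem ps) mem_iota.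
have pna := na_perm gg_sa_perm; have pnb := nb_perm gg_sb_perm.
have [wfq _ _ _ st1] := assignment_cycles_spec wf0 (allN _ pna) (allN _ pnb).
have szes : size es = m by rewrite (perm_size gg_es_perm) size_map size_iota.
have szes0 : size (result (exchange_costs 0 sa sb)) = m.
  by rewrite -(perm_size (perm_msort _)).
have st2 := steps_kruskal (nseq m false) wfq NK esN.
have szk f : size ((0, 0) :: result (keys f 1 js)) = N.
  by rewrite /= result_keys size_map size_iota.
have st3 f : steps (msort ((0, 0) :: result (keys f 1 js))) <= 2 * N * K + 4 * N + 1.
  by have := @steps_msort ((0, 0) :: result (keys f 1 js)) K; rewrite szk; apply.
have st4 : steps (msort (result (exchange_costs 0 sa sb))) <= 2 * m * K + 4 * m + 1.
  by have := @steps_msort (result (exchange_costs 0 sa sb)) K; rewrite szes0; apply; lia.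
have st5 := steps_exchange_costs 0 sa sb.
have st6 := steps_exchange (head (0, 0) sa).2 sel (behead sa) (behead sb).
have st7 := steps_set_successors sb (r.1 :: r.2) (nseq N 0).
rewrite size_sa' in st5; rewrite size_sel' in st6; rewrite size_sb' in st7.
rewrite szes in st2; rewrite size_sa' in st1.
have szvs : size vs = m by rewrite (perm_size gg_tour.1) size_iota.
(* The 8 is 2 for each of the three sorts and 2 for the disjoint sets: [kruskal] starts from the
   potential that [assignment_cycles] leaves, so their bounds [st1] and [st2] telescope. *)
eapply leq_trans.
  eapply steps_bind_le; first by rewrite steps_length.
  rewrite result_length -/m -/N.
  eapply steps_bind_le; first by rewrite steps_keys.
  eapply steps_bind_le; first by rewrite steps_keys.
  eapply steps_bind_le; first exact: st3.
  eapply steps_bind_le; first exact: st3.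
  rewrite -/sa -/sb.
  eapply steps_bind_le; first by rewrite steps_singletons.
  rewrite -/q0.
  eapply steps_bind_le; first exact: leqnn.
  rewrite -/q.
  eapply steps_bind_le; first exact: st5.
  eapply steps_bind_le; first exact: st4.
  rewrite -/es.
  eapply steps_bind_le; first by rewrite steps_amake.
  rewrite result_amake.
  eapply steps_bind_le; first exact: leqnn.
  rewrite -/sel.
  eapply steps_bind_le; first exact: st6.
  rewrite -/r.
  eapply steps_bind_le; first by rewrite steps_amake.
  rewrite result_amake.
  eapply steps_bind_le; first exact: st7.
  rewrite -/succ.
  eapply steps_bind_le; first by rewrite steps_follow.
  rewrite -/vs.
  by rewrite steps_timetable szvs.
rewrite -/q0 -/q in st1 st2 *.
by rewrite /N in st1 st2 *; nia.
Qed.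

End GilmoreGomory.

(** * Timetables *)

Section Orders.
Variable jb : nat -> job.

Fixpoint starts t x (o : seq nat) : seq (nat * nat) :=
  if o is i :: o' then
    let t1 := t + len1 x + (len2 x - len1 (jb i)) in
    (i, t1) :: starts t1 (jb i) o'
  else [::].

Fixpoint job_cost x (o : seq nat) :=
  if o is i :: o' then (len2 x - len1 (jb i)) + job_cost (jb i) o' else len2 x.

Definition entry L (z : nat * nat) := (z.1, (z.2, z.2 + len1 (jb z.1) + L)).
Definition finish L (z : nat * nat) := z.2 + len1 (jb z.1) + L + len2 (jb z.1).

Definition lookup (S : seq (nat * nat)) i := nth 0 (map snd S) (index i (map fst S)).

Lemma lookup_mem S i : i \in map fst S -> (i, lookup S i) \in S.
Proof.
rewrite /lookup; elim: S => //= z S IH; rewrite inE eq_sym.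
case: (eqVneq z.1 i) => [<-|ne] /= h; first by rewrite inE -surjective_pairing eqxx.
by rewrite inE IH // orbT.
Qed.

Lemma lookup_eq S z : uniq (map fst S) -> z \in S -> lookup S z.1 = z.2.
Proof.
rewrite /lookup; elim: S => //= z' S IH /andP[zS uS]; rewrite inE.
case/orP => [/eqP ->|zin]; first by rewrite eqxx.
by case: eqP => [e|_] /=; [rewrite e map_f in zS | apply: IH].
Qed.

Lemma map_fst_starts t x o : map fst (starts t x o) = o.
Proof. by elim: o t x => //= i o IH t x; rewrite IH. Qed.

(** Precedence on both machines, the common delay being cancelled on the second one. *)
Definition before (z z' : nat * nat) :=
  (z.2 + len1 (jb z.1) <= z'.2) &&
  (z.2 + len1 (jb z.1) + len2 (jb z.1) <= z'.2 + len1 (jb z'.1)).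

Lemma pairwise_starts t x o : pairwise before (starts t x o).
Proof.
rewrite -sorted_pairwise; last first.
  by move=> z' z z''; rewrite /before; lia.
case: o => //= i o; move: (t + _ + _) => {}t.
elim: o i t => //= j o IH i t; rewrite IH andbT.
by rewrite /before /=; lia.
Qed.

(** Idle time on machine 1 is exactly the truncated differences, so only [job_cost] depends on the
    order. The first conjunct lets the induction cover the head of the list. *)
Lemma starts_finish t x o : (t + len1 x + len2 x <=
    t + len1 x + \sum_(i <- o) len1 (jb i) + job_cost x o) /\
  (forall z, z \in starts t x o -> finish 0 z <=
    t + len1 x + \sum_(i <- o) len1 (jb i) + job_cost x o).
Proof.
elim: o t x => [|i o IH] t x /=; first by rewrite big_nil addn0; split.
rewrite big_cons; have [h1 h2] := IH (t + len1 x + (len2 x - len1 (jb i))) (jb i).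
split; first by lia.
move=> z; rewrite inE => /orP[/eqP ->|/h2]; last by lia.
by rewrite /finish /=; lia.
Qed.

Lemma result_timetable L js t x vs :
  all (leq 1) vs ->
  (forall v, v \in vs -> node js v = ((node js v).1, jb (node js v).1)) ->
  let S := starts t x (map (fun v => (node js v).1) vs) in
  result (timetable L js t x vs) = (map (entry L) S, \max_(z <- S) finish L z).
Proof.
elim: vs t x => [|v vs IH] t x /=; first by rewrite big_nil.
move=> /andP[v0 vs0] nd; rewrite !resultE.
have -> : nth (0, Job 0 0 0) js v.-1 = node js v by case: (v) v0.
have -> : (node js v).2 = jb (node js v).1 by rewrite nd ?mem_head.
rewrite IH //; last by move=> w wvs; apply: nd; rewrite inE wvs orbT.
by rewrite big_cons.
Qed.

Variable is_ : seq nat.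
Hypothesis is_uniq : uniq is_.
Let js := [seq (i, jb i) | i <- is_].

Lemma gilmore_gomory_spec L : exists o,
  [/\ perm_eq o is_,
      let S := starts 0 (Job 0 0 0) o in
        result (gilmore_gomory L js) = (map (entry L) S, \max_(z <- S) finish L z)
    & forall o', perm_eq o' is_ ->
        job_cost (Job 0 0 0) o <= job_cost (Job 0 0 0) o'].
Proof.
have [vs []] := gg_optimal_tour js L; rewrite size_map => pvs gr mvs.
pose idx v := (node js v).1.
have nodeS k : k < size is_ -> node js k.+1 = (nth 0 is_ k, jb (nth 0 is_ k)).
  by move=> km; rewrite /node /= (nth_map 0).
have vsP v : (0 < v) && (v < (size is_).+1) -> node js v = (idx v, jb (idx v)).
  by case: v => // k km; rewrite /idx nodeS.
have costE ws v : {subset ws <= iota 1 (size is_)} ->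
    tour_cost (fun v => len1 (node js v).2) (fun v => len2 (node js v).2) v ws =
    job_cost (node js v).2 (map idx ws).
  elim: ws v => //= w ws IH v sub; rewrite IH; last first.
    by move=> u uws; apply: sub; rewrite inE uws orbT.
  have -> // : (node js w).2 = jb (idx w).
  by rewrite vsP //; have := sub w (mem_head _ _); rewrite mem_iota.
have permidx : perm_eq (map idx (iota 1 (size is_))) is_.
  rewrite (iotaDl 1 0) -map_comp (_ : map _ _ = is_) //.
  rewrite -[RHS](mkseq_nth 0) /mkseq; apply/eq_in_map => k; rewrite mem_iota => km.
  by rewrite /= /idx nodeS.
have vsin : {subset vs <= iota 1 (size is_)} by move=> v; rewrite (perm_mem pvs).
exists (map idx vs); split.
- exact: perm_trans (perm_map _ pvs) permidx.
- rewrite gr (@result_timetable L js) //.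
    by apply/allP => v /vsin; rewrite mem_iota => /andP[].
  by move=> v /vsin; rewrite mem_iota => /vsP.
- move=> o' po'; pose vs' := [seq (index i is_).+1 | i <- o'].
  have pvs' : perm_eq vs' (iota 1 (size is_)).
    rewrite (iotaDl 1 0) /vs'.
    have -> : [seq (index i is_).+1 | i <- o'] = map (addn 1) (map (index^~ is_) o').
      by rewrite -map_comp; apply: eq_map.
    apply: perm_map; apply: perm_trans (perm_map _ po') _.
    rewrite (_ : map _ _ = iota 0 (size is_)) //.
    apply: (@eq_from_nth _ 0); rewrite size_map ?size_iota // => k km.
    by rewrite (nth_map 0) // index_uniq // nth_iota.
  have idxvs' : map idx vs' = o'.
    rewrite -map_comp -[RHS]map_id; apply/eq_in_map => i io'.
    have iis : i \in is_ by rewrite -(perm_mem po').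
    by rewrite /= /idx nodeS ?index_mem // nth_index.
  have := mvs _ pvs'; rewrite !costE ?idxvs' //.
  by move=> v; rewrite (perm_mem pvs').
Qed.

End Orders.

(** * Output and cost of the concatenation *)

Lemma steps_write_schedule c es out : steps (write_schedule c es out) = 2 * size es + 1.
Proof. by elim: es out => //= e es IH out; rewrite !stepsE IH; lia. Qed.

Lemma nth_write_schedule jb L c S out i : uniq (map fst S) ->
  nth (0, 0) (result (write_schedule c (map (entry jb L) S) out)) i =
  if i \in map fst S
  then (c + lookup S i, c + (lookup S i + len1 (jb i) + L))
  else nth (0, 0) out i.
Proof.
elim: S out => //= z S IH out /andP[zS uS]; rewrite !resultE IH // inE.
rewrite nth_set_nth /= /lookup /= (eq_sym z.1).
case: eqP => [->|_] //=; by rewrite (negPf zS).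
Qed.

Section Concatenation.
Variable I : seq job.
Let jb i := nth (Job 0 0 0) I i.
Let n := size I.

Definition indices L := filter (fun i => delay (jb i) == L) (iota 0 n).

Lemma steps_select_delay L k s : steps (select_delay L k s) = (size s).+1.
Proof. by elim: s k => //= x s IH k; rewrite !stepsE IH; lia. Qed.

Lemma result_select_delay L k s :
  result (select_delay L k s) =
  [seq (k + i, nth (Job 0 0 0) s i) |
     i <- filter (fun i => delay (nth (Job 0 0 0) s i) == L) (iota 0 (size s))].
Proof.
elim: s k => //= x s IH k; rewrite !resultE IH (iotaDl 1 0) filter_map /=.
have e : [seq (k.+1 + i, nth (Job 0 0 0) s i) |
     i <- filter (fun i => delay (nth (Job 0 0 0) s i) == L) (iota 0 (size s))] =
  [seq (k + i, nth (Job 0 0 0) (x :: s) i) | i <- map (addn 1)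
    (filter (preim (addn 1) (fun i => delay (nth (Job 0 0 0) (x :: s) i) == L))
      (iota 0 (size s)))].
  by rewrite -map_comp; apply: eq_map => i /=; rewrite add1n addnS.
by rewrite e; case: ifP => _ //=; rewrite addn0.
Qed.

Lemma selected_jobs L : result (select_delay L 0 I) = [seq (i, jb i) | i <- indices L].
Proof. exact: result_select_delay. Qed.

Lemma indices_uniq L : uniq (indices L).
Proof. by rewrite filter_uniq ?iota_uniq. Qed.

Definition optimal_order L o := perm_eq o (indices L) /\
  forall o', perm_eq o' (indices L) ->
    job_cost jb (Job 0 0 0) o <= job_cost jb (Job 0 0 0) o'.

Lemma result_concatenation L1 L2 : exists o1 o2,
  [/\ optimal_order L1 o1, optimal_order L2 o2 &
   let S1 := starts jb 0 (Job 0 0 0) o1 in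
   let S2 := starts jb 0 (Job 0 0 0) o2 in
   let mk := \max_(z <- S1) finish jb L1 z in
   forall i, nth (0, 0) (result (concatenation L1 L2 I)) i =
     if i \in indices L1 then (lookup S1 i, lookup S1 i + len1 (jb i) + L1)
     else if i \in indices L2 then
       (mk + lookup S2 i, mk + (lookup S2 i + len1 (jb i) + L2))
     else (0, 0)].
Proof.
have [o1 [p1 r1 m1]] := gilmore_gomory_spec jb (indices_uniq L1) L1.
have [o2 [p2 r2 m2]] := gilmore_gomory_spec jb (indices_uniq L2) L2.
exists o1, o2; split=> // S1 S2 mk i.
rewrite /concatenation 7!result_bind !selected_jobs r1 r2 /= -/S1 -/S2 -/mk.
have f1 : map fst S1 = o1 by apply: map_fst_starts.
have f2 : map fst S2 = o2 by apply: map_fst_starts.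
rewrite !nth_write_schedule ?f1 ?f2 ?(perm_uniq p1) ?(perm_uniq p2) ?indices_uniq //.
rewrite (perm_mem p1) (perm_mem p2) result_amake nth_nseq if_same.
by rewrite !add0n.
Qed.

(** Twice the bound of one run of Gilmore-Gomory, plus linear terms. The strict hypothesis makes
    room for the dummy node. *)
Lemma steps_concatenation L1 L2 K : n < 2 ^ K ->
  steps (concatenation L1 L2 I) <= 120 * n.+1 + 16 * (n.+1 * K).
Proof.
move=> nK.
have szi L : size (indices L) <= n.
  by rewrite size_filter -[X in _ <= X](size_iota 0); apply: count_size.
have st L : steps (gilmore_gomory L [seq (i, jb i) | i <- indices L]) <=
    50 * n.+1 + 8 * (n.+1 * K).
  have := @steps_gilmore_gomory [seq (i, jb i) | i <- indices L] L K.
  have := szi L; rewrite size_map => h1 /(_ ltac:(lia)) h2.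
  by apply: leq_trans h2 _; nia.
have szs L : size (result (gilmore_gomory L [seq (i, jb i) | i <- indices L])).1 <= n.
  have [o [p -> _]] := gilmore_gomory_spec jb (indices_uniq L) L.
  rewrite size_map -(size_map fst) map_fst_starts (perm_size p); exact: szi.
rewrite /concatenation; eapply leq_trans.
  eapply steps_bind_le; first by rewrite steps_select_delay.
  eapply steps_bind_le; first by rewrite steps_select_delay.
  rewrite !selected_jobs.
  eapply steps_bind_le; first exact: st.
  eapply steps_bind_le; first exact: st.
  eapply steps_bind_le; first by rewrite steps_length.
  rewrite result_length.
  eapply steps_bind_le; first by rewrite steps_amake.
  eapply steps_bind_le; first by rewrite steps_write_schedule.
  by rewrite steps_write_schedule.
by have := szs L1; have := szs L2; rewrite -/n; lia.
Qed.

End Concatenation.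

(** * Integral schedules *)

Section IntegralSchedules.
Variables (R : archiRealFieldType) (n : nat) (I : n.-tuple job).
Implicit Types (J : {set 'I_n}) (T : 'I_n -> nat) (s : schedule R n).
Let la j := len1 (tnth I j).
Let ld j := delay (tnth I j).
Let lb j := len2 (tnth I j).

Definition nat_schedule T : schedule R n :=
  fun j => ((T j)%:R%R, (T j + la j + ld j)%:R%R).

Definition nfeasible J T :=
  [forall i in J, forall j in J, (i != j) ==>
     ((T i + la i <= T j) || (T j + la j <= T i)) &&
     ((T i + la i + ld i + lb i <= T j + la j + ld j) ||
      (T j + la j + ld j + lb j <= T i + la i + ld i))].

Definition nmakespan J T := \max_(j in J) (T j + la j + ld j + lb j).

Lemma nfeasibleP J T : reflect (forall i j, i \in J -> j \in J -> i != j ->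
    ((T i + la i <= T j) || (T j + la j <= T i)) /\
    ((T i + la i + ld i + lb i <= T j + la j + ld j) ||
      (T j + la j + ld j + lb j <= T i + la i + ld i))) (nfeasible J T).
Proof.
apply: (iffP forall_inP) => [h i j iJ jJ ij|h i iJ].
  by have /forall_inP/(_ j jJ)/implyP/(_ ij)/andP := h i iJ.
by apply/forall_inP => j jJ; apply/implyP => ij; apply/andP; apply: h.
Qed.

Lemma eq_nfeasible J T T' : {in J, T =1 T'} -> nfeasible J T = nfeasible J T'.
Proof.
move=> e; apply/nfeasibleP/nfeasibleP => h i j iJ jJ ij; have := h i j iJ jJ ij;
by rewrite !e.
Qed.

Lemma eq_nmakespan J T T' : {in J, T =1 T'} -> nmakespan J T = nmakespan J T'.
Proof. by move=> e; apply: eq_bigr => j jJ; rewrite e. Qed.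

Lemma nfeasible_sub J J' T : J \subset J' -> nfeasible J' T -> nfeasible J T.
Proof.
move=> /subsetP JJ' /nfeasibleP h; apply/nfeasibleP => i j iJ jJ.
by apply: h; apply: JJ'.
Qed.

Lemma nmakespan_sub J J' T : J \subset J' -> nmakespan J T <= nmakespan J' T.
Proof.
move=> /subsetP JJ'; apply/bigmax_leqP => j jJ.
by apply: (leq_bigmax_cond (F := fun j => T j + la j + ld j + lb j)); apply: JJ'.
Qed.

Lemma eq_feasible J s s' : {in J, s =1 s'} -> feasible I J s -> feasible I J s'.
Proof.
move=> e [h1 h2 h3 h4]; split=> [j jJ|j jJ|i j iJ jJ ij|i j iJ jJ ij].
- by have := h1 j jJ; rewrite /start1 /start2 e.
- by have := h2 j jJ; rewrite /end1 /start1 /start2 e.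
- by have := h3 i j iJ jJ ij; rewrite /end1 /start1 !e.
- by have := h4 i j iJ jJ ij; rewrite /end2 /start2 !e.
Qed.

Lemma eq_makespan J s s' : {in J, s =1 s'} -> makespan I J s = makespan I J s'.
Proof.
move=> e; apply: eq_bigr => j jJ.
by rewrite /end1 /end2 /start1 /start2 e.
Qed.

Lemma feasible_nat J T : nfeasible J T -> feasible I J (nat_schedule T).
Proof.
move=> /nfeasibleP h; split=> [j jJ|j jJ|i j iJ jJ ij|i j iJ jJ ij].
- by rewrite /start1 /start2 /= !ler0n.
- by rewrite /start2 /end1 /start1 /= !natrD.
- have [/orP[h1|h1] _] := h i j iJ jJ ij; [left|right];
  by rewrite /end1 /start1 /= -natrD ler_nat.
- have [_ /orP[h1|h1]] := h i j iJ jJ ij; [left|right];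
  by rewrite /end2 /start2 /= -natrD ler_nat.
Qed.

Lemma makespan_nat J T : makespan I J (nat_schedule T) = (nmakespan J T)%:R%R.
Proof.
rewrite /nmakespan (big_morph (fun k => k%:R%R : R) (id1 := 0%R) (op1 := Num.max)) //.
  apply: eq_bigr => j _; rewrite /end1 /end2 /start1 /start2 /= -!natrD.
  by rewrite max_r // ler_nat; rewrite /la /ld /lb; lia.
by move=> x y; rewrite -maxEnat natr_max.
Qed.

Lemma makespan_ge J s j : j \in J ->
  (end1 I s j <= makespan I J s)%R /\ (end2 I s j <= makespan I J s)%R.
Proof.
move=> jJ; have := @le_bigmax_cond _ _ _ 0%R j (mem J)
  (fun j => Num.max (end1 I s j) (end2 I s j)) jJ.
by rewrite ge_max => /andP[].
Qed.

(* Rounding all start times down keeps a schedule feasible. *)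
Lemma feasible_round J s : feasible I J s ->
  exists2 T, nfeasible J T & ((nmakespan J T)%:R <= makespan I J s)%R.
Proof.
case=> h1 h2 h3 h4; pose T j := Num.truncn (start1 s j).
have Tle j : j \in J -> ((T j)%:R <= start1 s j)%R.
  by move=> /h1[s0 _]; rewrite truncn_le.
(* An integer is below a nonnegative number exactly when it is below its floor; truncated
   subtraction requires the case [T i + x <= y] to be treated apart. *)
have round i j x y : i \in J -> j \in J ->
    (start1 s i + x%:R <= start1 s j + y%:R)%R -> T i + x <= T j + y.
  move=> iJ jJ le; case: (leqP (T i + x) y) => [h|h].
    exact: leq_trans h (leq_addl _ _).
  rewrite (addnC (T j)) -leq_subLR {2}/T truncn_ge_nat ?(h1 j jJ).1 // natrB ?(ltnW h) //.
  rewrite lerBlDr; apply: le_trans le; rewrite natrD lerD2r; exact: Tle.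
exists T.
  apply/nfeasibleP => i j iJ jJ ij; split.
    have [h|h] := h3 i j iJ jJ ij; apply/orP; [left|right];
    by rewrite -[X in _ <= X]addn0; apply: round => //; rewrite addr0.
  have e2 k : k \in J -> start2 s k = (start1 s k + (la k + ld k)%:R)%R.
    by move=> kJ; rewrite h2 // /end1 natrD addrA.
  have [h|h] := h4 i j iJ jJ ij; apply/orP; [left|right]; rewrite -!addnA;
  by apply: round => //; rewrite addnA natrD addrA -!e2.
rewrite -makespan_nat; apply: bigmax_le; first exact: bigmax_ge_id.
move=> j jJ; have [m1 m2] := makespan_ge s jJ.
rewrite ge_max; apply/andP; split.
  by apply: le_trans m1; rewrite /end1 lerD2r; apply: Tle.
apply: le_trans m2; rewrite /end2 lerD2r /start2 /=.
have := h2 j jJ; rewrite /start2 => ->.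
by rewrite /end1 !natrD !lerD2r; apply: Tle.
Qed.

Lemma optimal_nat J T s : {in J, s =1 nat_schedule T} -> nfeasible J T ->
  (forall T', nfeasible J T' -> nmakespan J T <= nmakespan J T') -> optimal I J s.
Proof.
move=> e fT mT; have e' : {in J, nat_schedule T =1 s} by move=> j jJ; rewrite e.
split; first exact: eq_feasible e' (feasible_nat fT).
move=> s' /feasible_round[T' fT' le]; apply: le_trans le.
by rewrite (eq_makespan e) makespan_nat ler_nat; apply: mT.
Qed.

(* A feasible schedule bounds the start times of an optimal one, which is thus
   found among finitely many. *)
Lemma nat_optimum J T0 : nfeasible J T0 -> exists2 T, nfeasible J T &
  forall T', nfeasible J T' -> nmakespan J T <= nmakespan J T'.
Proof.
move=> f0; pose B := nmakespan J T0.
pose cut T : {ffun 'I_n -> 'I_B.+1} := [ffun j => inord (T j)].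
have cutE T : nmakespan J T <= B -> {in J, T =1 (fun j => val (cut T j))}.
  move=> le j jJ; rewrite ffunE /= inordK // ltnS; apply: leq_trans le.
  apply: leq_trans (leq_bigmax_cond (F := fun j => T j + la j + ld j + lb j) _ jJ).
  by rewrite -!addnA leq_addr.
have f0' : nfeasible J (fun j => val (cut T0 j)).
  by rewrite -(eq_nfeasible (cutE T0 (leqnn _))).
pose F (f : {ffun 'I_n -> 'I_B.+1}) := nmakespan J (fun j => val (f j)).
case: (@arg_minnP _ (cut T0) (fun f => nfeasible J (fun j => val (f j))) F f0').
move=> f ff mf; exists (fun j => val (f j)) => // T' fT'.
(* Beyond [B] a schedule is already beaten by [T0], which lies in the search space. *)
case: (leqP (nmakespan J T') B) => [le|gt].
  rewrite (eq_nmakespan (cutE _ le)); apply: mf.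
  by rewrite -(eq_nfeasible (cutE _ le)).
have e0 := eq_nmakespan (cutE T0 (leqnn _)).
by apply: leq_trans (mf _ f0') _; rewrite /F -e0; apply: ltnW.
Qed.

End IntegralSchedules.

(** * Common delays *)

Lemma pairwise_or (A : eqType) (r : rel A) (s : seq A) x y :
  pairwise r s -> x \in s -> y \in s -> x != y -> r x y \/ r y x.
Proof.
elim: s => //= z s IH /andP[/allP zs ps]; rewrite !inE.
case/orP => [/eqP ->|xs]; case/orP => [/eqP ->|ys]; rewrite ?eqxx //.
- by left; apply: zs.
- by right; apply: zs.
- exact: IH.
Qed.

Section CommonDelay.
Variables (n : nat) (I : n.-tuple job) (L : nat).
Let jb i := nth (Job 0 0 0) I i.
Let J := jobs_with_delay I L.

Lemma jobE (j : 'I_n) : jb j = tnth I j.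
Proof. by rewrite /jb -tnth_nth. Qed.

Lemma mem_indices (j : 'I_n) : (val j \in indices I L) = (j \in J).
Proof.
by rewrite mem_filter mem_iota size_tuple /= ltn_ord andbT inE -jobE.
Qed.

Lemma indices_enum : perm_eq (map val (enum J)) (indices I L).
Proof.
apply: uniq_perm; first by rewrite map_inj_uniq ?enum_uniq //; apply: val_inj.
  exact: indices_uniq.
move=> i; apply/mapP/idP => [[j + ->]|ii]; first by rewrite mem_enum mem_indices.
have iN : i < n by move: ii; rewrite mem_filter mem_iota size_tuple => /andP[_].
by exists (Ordinal iN) => //; rewrite mem_enum -mem_indices.
Qed.

Let null (j : 'I_n) := (len1 (tnth I j) == 0) && (len2 (tnth I j) == 0).

(* A job with two operations of length 0 may come between the operations of
   another job, after its first operation and before its second one. Such jobs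
   are moved to the front, where they cost nothing; any other two jobs come in
   the same order on both machines. *)
Lemma order_lower_bound T : nfeasible I J T -> J != set0 ->
  exists2 o, perm_eq o (indices I L) &
    L + \sum_(i <- o) len1 (jb i) + job_cost jb (Job 0 0 0) o <= nmakespan I J T.
Proof.
move=> /nfeasibleP feas /set0Pn[j0 j0J].
have dJ j : j \in J -> delay (tnth I j) = L by rewrite inE => /eqP.
have mk j : j \in J -> T j + len1 (tnth I j) + L + len2 (tnth I j) <= nmakespan I J T.
  move=> jJ; rewrite -[L](dJ j jJ).
  exact: (leq_bigmax_cond (F := fun j =>
    T j + len1 (tnth I j) + delay (tnth I j) + len2 (tnth I j))).
pose prec (i j : 'I_n) := (T i + len1 (tnth I i) <= T j) &&
  (T i + len1 (tnth I i) + len2 (tnth I i) <= T j + len1 (tnth I j)).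
(* The diagonal and the jobs outside [J] are included to make [le] total on the whole type, as
   sorting asks. *)
pose le (i j : 'I_n) :=
  [|| i == j, null i, i \notin J, j \notin J | ~~ null j && prec i j].
have le_total : total le.
  move=> i j; rewrite /le (eq_sym j); case: (eqVneq i j) => //= ij.
  case: (boolP (null i)) => //= ni; case: (boolP (null j)) => [_|nj]; rewrite ?orbT //=.
  case: (boolP (i \in J)) => iJ; rewrite ?orbT //=.
  case: (boolP (j \in J)) => jJ; rewrite ?orbT //=.
  (* Opposite orders on the two machines would squeeze one of the two jobs to total length 0,
     contrary to [ni] and [nj]. *)
  have [] := feas i j iJ jJ ij; rewrite !dJ // /prec.
  by move: ni nj; rewrite /null; clear; lia.
pose s := sort le (enum J).
have ps : perm_eq s (enum J) by rewrite perm_sort.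
have sJ j : j \in s -> j \in J by rewrite (perm_mem ps) mem_enum.
have us : uniq s by rewrite (perm_uniq ps) enum_uniq.
exists (map val s); first exact: perm_trans (perm_map _ ps) indices_enum.
(* [t] is the start time in the compact timetable: 0 along the null jobs at the front, and at most
   [T i] from then on. *)
have walk (i : 'I_n) w t : path le i w -> uniq (i :: w) -> {subset i :: w <= J} ->
    (null i -> t = 0) -> (~~ null i -> t <= T i) ->
    L + (t + len1 (jb i) + \sum_(k <- map val w) len1 (jb k)
      + job_cost jb (jb i) (map val w)) <= nmakespan I J T.
  elim: w i t => [|j w IH] i t /=.
    move=> _ _ sub t0 tT; rewrite big_nil jobE; case: (boolP (null i)) => ni.
      have := mk i (sub i (mem_head _ _)); have := t0 ni; move: ni; rewrite /null; clear; lia.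
    by have := mk i (sub i (mem_head _ _)); have := tT ni; clear; lia.
  move=> /andP[leij pw] /andP[iw uw] sub t0 tT; rewrite big_cons.
  have iJ : i \in J by apply: sub; rewrite inE eqxx.
  have jJ : j \in J by apply: sub; rewrite !inE eqxx orbT.
  have ij : i != j by move: iw; rewrite inE negb_or => /andP[].
  have := IH j (t + len1 (jb i) + (len2 (jb i) - len1 (jb j))) pw uw.
  move: leij; rewrite /le (negPf ij) iJ jJ /= !jobE => leij H.
  apply: leq_trans (H _ _ _); first by clear; lia.
  - by move=> k kw; apply: sub; rewrite inE kw orbT.
  - move=> nj; case: (boolP (null i)) leij => [ni|_ /=]; last by rewrite nj.
    by have := t0 ni; move: ni nj; rewrite /null; clear; lia.
  - move=> nj; case: (boolP (null i)) leij => [ni _|ni /andP[_ pij]].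
      by have := t0 ni; move: ni; rewrite /null; clear; lia.
    by have := tT ni; move: pij; rewrite /prec; clear; lia.
have : sorted le s by apply: sort_sorted.
case: (s) us sJ ps => [|i w] us sJ ps srt.
  by have := perm_mem ps j0; rewrite mem_enum j0J.
have := @walk i w 0 srt us; rewrite /= big_cons /= => H.
by apply: leq_trans (H _ _ _) => //; clear; lia.
Qed.

Variable o : seq nat.
Hypothesis o_opt : optimal_order I L o.
Let S := starts jb 0 (Job 0 0 0) o.
Let T (j : 'I_n) := lookup S j.

Let fstS : map fst S = o.
Proof. exact: map_fst_starts. Qed.

Let uniqS : uniq (map fst S).
Proof. by rewrite fstS (perm_uniq o_opt.1) indices_uniq. Qed.

Let T_mem j : j \in J -> (val j, T j) \in S.
Proof.
by move=> jJ; apply: lookup_mem; rewrite fstS (perm_mem o_opt.1) mem_indices.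
Qed.

Lemma order_feasible : nfeasible I J T.
Proof.
have dJ j : j \in J -> delay (tnth I j) = L by rewrite inE => /eqP.
apply/nfeasibleP => i j iJ jJ ij; rewrite !dJ //.
have ne : (val i, T i) != (val j, T j) by apply: contra ij => /eqP[] /val_inj ->.
have := pairwise_or (pairwise_starts _ _ _ _) (T_mem iJ) (T_mem jJ) ne.
by rewrite /before /= !jobE; clear; lia.
Qed.

Lemma order_makespan : nmakespan I J T = \max_(z <- S) finish jb L z.
Proof.
have dJ j : j \in J -> delay (tnth I j) = L by rewrite inE => /eqP.
apply/eqP; rewrite eqn_leq; apply/andP; split.
  apply/bigmax_leqP => j jJ; have := leq_bigmax_seq (F := finish jb L) (P := xpredT) _ (T_mem jJ) isT.
  by rewrite /finish /= jobE dJ.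
apply/bigmax_leqP_seq => z zS _.
have : z.1 \in indices I L by rewrite -(perm_mem o_opt.1) -fstS map_f.
move=> zi; have zn : z.1 < n.
  by move: zi; rewrite mem_filter mem_iota size_tuple => /andP[_].
pose j := Ordinal zn; have jJ : j \in J by rewrite -mem_indices.
have := leq_bigmax_cond (F := fun j =>
  T j + len1 (tnth I j) + delay (tnth I j) + len2 (tnth I j)) _ jJ.
by rewrite dJ // -jobE /T (lookup_eq uniqS zS).
Qed.

(** The lower bound for [T'] and the makespan of [T] share [L] and the sum of the first operations;
    they differ only in [job_cost], which [o] minimizes. *)
Lemma order_optimal T' : nfeasible I J T' -> nmakespan I J T <= nmakespan I J T'.
Proof.
have [->|J0] := eqVneq J set0; first by rewrite /nmakespan big_set0.
move=> /order_lower_bound/(_ J0)[o' po' le]; apply: leq_trans le.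
have := o_opt.2 _ po'; have po : perm_eq o o' by rewrite (perm_trans o_opt.1) // perm_sym.
rewrite -(perm_big _ po) order_makespan /= => le.
apply/bigmax_leqP_seq => z zS _.
have := (starts_finish jb 0 (Job 0 0 0) o).2 z zS; rewrite /finish /=.
by move: le; rewrite -/jb; clear; lia.
Qed.

End CommonDelay.

(** * Approximation ratio and running time of the concatenation *)

Theorem theorem2 :
  exists C n0 : nat,
  forall (R : archiRealFieldType) (n L1 L2 : nat) (I : n.-tuple job),
    (forall j : 'I_n, delay (tnth I j) = L1 \/ delay (tnth I j) = L2) ->
    let run := concatenation L1 L2 I in
    let sigma : schedule R n := schedule_of R n (result run) in
    [/\ concatenation_output I L1 L2 sigma,
        feasible I [set: 'I_n] sigma,
        (exists2 opt : R, optimal_makespan I [set: 'I_n] opt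
           & (makespan I [set: 'I_n] sigma <= 2%:R * opt)%R)
      & n0 <= n -> steps run <= C * (n * trunc_log 2 n)].
Proof.
(* [304 = 2 * 120 + 4 * 16], from [n.+1 <= 2 * n] and [trunc_log 2 n + 1 <= 2 * trunc_log 2 n]; the
   latter fails at [n = 1], where the logarithm is 0. *)
exists 304, 2 => R n L1 L2 I dL run sigma.
have [o1 [o2 [opt1 opt2 outE]]] := result_concatenation I L1 L2.
set J1 := jobs_with_delay I L1; set J2 := jobs_with_delay I L2.
pose T1 (j : 'I_n) := lookup (starts (nth (Job 0 0 0) I) 0 (Job 0 0 0) o1) j.
pose T2 (j : 'I_n) := lookup (starts (nth (Job 0 0 0) I) 0 (Job 0 0 0) o2) j.
have f1 : nfeasible I J1 T1 := order_feasible opt1.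
have f2 : nfeasible I J2 T2 := order_feasible opt2.
have m1 := order_makespan opt1; rewrite -/J1 -/T1 in m1.
have min1 : forall T, nfeasible I J1 T -> nmakespan I J1 T1 <= nmakespan I J1 T :=
  order_optimal opt1.
have min2 : forall T, nfeasible I J2 T -> nmakespan I J2 T2 <= nmakespan I J2 T :=
  order_optimal opt2.
have d1 j : j \in J1 -> delay (tnth I j) = L1 by rewrite inE => /eqP.
have d2 j : j \notin J1 -> j \in J2 /\ delay (tnth I j) = L2.
  by rewrite !inE; case: (dL j) => ->; rewrite eqxx.
pose T j := if j \in J1 then T1 j else nmakespan I J1 T1 + T2 j.
have sigmaE j : sigma j = nat_schedule R I T j.
  rewrite /sigma /schedule_of /run outE !mem_indices -/J1 -/J2 -m1 /nat_schedule /T.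
  case: (boolP (j \in J1)) => jJ.
    by rewrite /= -tnth_nth -[X in _ + X](d1 j jJ).
  have [jJ2 dj] := d2 j jJ.
  by rewrite jJ2 /= -tnth_nth -[X in (_ + (_ + X))%N]dj !addnA.
have T1ub j : j \in J1 ->
    T1 j + len1 (tnth I j) + delay (tnth I j) + len2 (tnth I j) <= nmakespan I J1 T1.
  by move=> jJ; apply: (leq_bigmax_cond (F := fun j =>
       T1 j + len1 (tnth I j) + delay (tnth I j) + len2 (tnth I j))).
(* Jobs on different sides cannot collide: those of [J1] are finished on both machines when the
   first of the others starts. *)
have fT : nfeasible I setT T.
  apply/nfeasibleP => i j _ _ ij; rewrite /T.
  have /nfeasibleP/(_ i j) := f1; have /nfeasibleP/(_ i j) := f2.
  case: (boolP (i \in J1)) => iJ; case: (boolP (j \in J1)) => jJ.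
  - by move=> _; apply.
  - by move=> _ _; have := T1ub i iJ; lia.
  - by move=> _ _; have := T1ub j jJ; lia.
  - have [iJ2 _] := d2 i iJ; have [jJ2 _] := d2 j jJ.
    by move=> /(_ iJ2 jJ2 ij) h _; lia.
have mT : nmakespan I setT T <= nmakespan I J1 T1 + nmakespan I J2 T2.
  apply/bigmax_leqP => j _; rewrite /T; case: (boolP (j \in J1)) => jJ.
    by have := T1ub j jJ; lia.
  have [jJ2 _] := d2 j jJ.
  have := leq_bigmax_cond (F := fun j =>
       T2 j + len1 (tnth I j) + delay (tnth I j) + len2 (tnth I j)) _ jJ2.
  by rewrite -/(nmakespan I J2 T2); lia.
split.
- exists (nat_schedule R I T1), (nat_schedule R I T2); split.
  + exact: (optimal_nat (T := T1)).
  + exact: (optimal_nat (T := T2)).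
  + move=> j; rewrite sigmaE /concat_schedules -/J1 makespan_nat /nat_schedule /T.
    case: (j \in J1) => //=.
    by rewrite /start1 /start2 /= !natrD !addrA.
- by apply: eq_feasible (feasible_nat R fT) => j _; rewrite sigmaE.
- have [T0 fT0 min0] := nat_optimum fT.
  exists (nmakespan I setT T0)%:R%R.
    exists (nat_schedule R I T0); last by rewrite makespan_nat.
    exact: (optimal_nat (T := T0)).
  rewrite (eq_makespan I (s' := nat_schedule R I T)); last by move=> j _.
  rewrite makespan_nat -natrM ler_nat.
  (* The global optimum [T0] competes with both partial optima, so each of them is at most its
     makespan. *)
  have le1 := min1 T0 (nfeasible_sub (subsetT _) fT0).
  have le2 := min2 T0 (nfeasible_sub (subsetT _) fT0).
  have := nmakespan_sub I T0 (subsetT J1); have := nmakespan_sub I T0 (subsetT J2).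
  by lia.
- move=> n2; have nK : size I < 2 ^ (trunc_log 2 n).+1.
    by rewrite size_tuple trunc_log_ltn.
  have l1 : 0 < trunc_log 2 n by rewrite trunc_log_gt0.
  have := steps_concatenation L1 L2 nK; rewrite size_tuple => h.
  apply: leq_trans h _; move: (trunc_log 2 n) l1 => k l1; nia.
Qed.
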